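(* The optimal control problem described in the context (minimize $J_N$ over all controls $u=(u(0),\dots,u(N-d))$ with $u(k-d)$ being $\mathcal{G}_{k-d}$-measurable for $k=d,\dots,N$) admits a unique optimal control if and only if $$W_{l_{k-d}}>0,\qquad k=N,N-1,\dots,d,\quad l_{k-d}\in\Theta,$$ where $W$ is generated by the backward coupled difference Riccati equation given in the context. In this case, the optimal control is, for $k=d,d+1,\dots,N$ and $\theta(k-d)=l_{k-d}\in\Theta$, $$u(k-d)=-W_{l_{k-d}}^{-1}T_{l_{k-d}}^0\,x(k-d+1)-\sum_{j=1}^{d-1}W_{l_{k-d}}^{-1}T_{l_{k-d}}^j\,u(k-2d+j);$$ the optimal costate is, for $k=d,\dots,N$ (with the matrices evaluated at $l_t=\theta(t)$), $$\lambda_{k-1}=(P_{l_{k-1}}-P_{l_{k-1}}^0)x(k)-\sum_{s=1}^{d-1}(\alpha_{l_{k-1},l_{k-s}}^{d-s})'W_{l_{k-s-1}}^{-1}\,\mathrm{E}\{\alpha_{l_{k-1},l_{k-s}}^{d-s}x(k)\mid\mathcal{G}_{k-s-1}\};$$ and the optimal cost is (again with $l_t=\theta(t)$) $$J_N^{*}=\mathrm{E}\Big\{\sum_{k=0}^{d-1}x(k)'Q_{l_k}x(k)+x(d)'(P_{l_{d-1}}-P_{l_{d-1}}^0)x(d)-x(d)'\sum_{s=1}^{d-1}(\alpha_{l_{d-1},l_{d-s}}^{d-s})'W_{l_{d-s-1}}^{-1}\,\mathrm{E}[\alpha_{l_{d-1},l_{d-s}}^{d-s}x(d)\mid\mathc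al{G}_{d-s-1}]\Big\}.$$
   Context: **System.** Let $d>0$ and $N>d$ be integers. $\theta(k)$, $k\ge 0$, is a discrete-time Markov chain with finite state space $\Theta=\{1,\dots,L\}$, transition probabilities $\lambda_{l_k,l_{k+1}}=\mathrm{P}(\theta(k+1)=l_{k+1}\mid\theta(k)=l_k)$ and distribution $\pi_{l_k}(k)=\mathrm{P}(\theta(k)=l_k)$. Let $\mathcal{G}_k$ be the $\sigma$-algebra generated by $\theta(0),\dots,\theta(k)$. Consider $$x(k+1)=A_{\theta(k)}(k)x(k)+B_{\theta(k)}(k)u(k-d),\qquad k=0,\dots,N,$$ with $x(k)\in\mathbb{R}^n$, $u(k)\in\mathbb{R}^m$, and deterministic matrices $A_l(k),B_l(k)$ ($l\in\Theta$) of appropriate dimensions. The initial values $x(0)=x_0$ and $u(-d),\dots,u(-1)$ are known, and $\theta$ is independent of them. The cost is $$J_N=\mathrm{E}\Big[\sum_{k=0}^N x(k)'Q_{\theta(k)}(k)x(k)+\sum_{k=d}^N u(k-d)'R_{\theta(k)}(k)u(k-d)+x(N+1)'P_{\theta(N+1)}(N+1)x(N+1)\Big],$$ with symmetric $Q_l(k)\ge0$, $R_l(k)\ge0$ and symmetric terminal penalties $P_l(N+1)$ ($l\in\Theta$). The prime denotes transpose; $M>0$ ($M\ge0$) means symmetric positive definite (semi-definite). The problem is to minimize $J_N$ over controls with $u(k)$ $\mathcal{G}_k$-measurable, $k=0,\dots,N-d$. **Notation.** $l_t\in\Theta$ denotes the mode at time $t$ (the value of $\theta(t)$), and explicit time arguments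 are suppressed: $M_{l_t}$ means $M_{l_t}(t)$. For $s<t$, $\Lambda_{l_s,l_t}$ denotes the iterated sum $\sum_{l_{s+1}=1}^L\lambda_{l_s,l_{s+1}}\cdots\sum_{l_t=1}^L\lambda_{l_{t-1},l_t}$ applied to the bracketed expression following it. $F_{l_t,l_i}=A_{l_t}A_{l_{t-1}}\cdots A_{l_i}$ for $i\le t$, and $F_{l_t,l_{t+1}}=I$. Empty sums are zero. **Costate.** Along the optimal trajectory, $\lambda_N=\mathrm{E}[P_{\theta(N+1)}x(N+1)\mid\mathcal{G}_N]$ and $\lambda_{k-1}=\mathrm{E}[A_{\theta(k)}'\lambda_k+Q_{\theta(k)}x(k)\mid\mathcal{G}_{k-1}]$. **Backward coupled difference Riccati equation.** Terminal values: $P_{l_N}=\Lambda_{l_N,l_{N+1}}[P_{l_{N+1}}]$; $P^0_{l_{N-i}}=0$ and $T^j_{l_{N-i}}=0$ for $i=0,\dots,d-1$, $j=0,\dots,d-1$. For $k=N,N-1,\dots,d$: $$W_{l_{k-d}}=\Lambda_{l_{k-d},l_k}[B_{l_k}'(P_{l_k}-P_{l_k}^0)B_{l_k}+R_{l_k}]-\sum_{s=1}^{d-1}\Lambda_{l_{k-d},l_{k-s}}[(T_{l_{k-s}}^s)'W_{l_{k-s}}^{-1}T_{l_{k-s}}^s],$$ $$T_{l_{k-d}}^0=\Lambda_{l_{k-d},l_k}[B_{l_k}'(P_{l_k}-P_{l_k}^0)F_{l_k,l_{k-d+1}}]-\sum_{s=1}^{d-1}\Lambda_{l_{k-d},l_{k-s}}[(T_{l_{k-s}}^s)'W_{l_{k-s}}^{-1}T_{l_{k-s}}^0F_{l_{k-s},l_{k-d+1}}],$$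 and for $j=1,\dots,d-1$ $$T_{l_{k-d}}^j=\Lambda_{l_{k-d},l_k}[B_{l_k}'(P_{l_k}-P_{l_k}^0)F_{l_k,l_{k-d+j+1}}B_{l_{k-d+j}}]-\sum_{s=1}^{d-j}\Lambda_{l_{k-d},l_{k-s}}[(T_{l_{k-s}}^s)'W_{l_{k-s}}^{-1}T_{l_{k-s}}^0F_{l_{k-s},l_{k-d+j+1}}B_{l_{k-d+j}}]-\sum_{s=d-j+1}^{d-1}\Lambda_{l_{k-d},l_{k-s}}[(T_{l_{k-s}}^s)'W_{l_{k-s}}^{-1}T_{l_{k-s}}^{s-(d-j)}].$$ For $k=N,\dots,1$: $P_{l_{k-1}}=\Lambda_{l_{k-1},l_k}[Q_{l_k}+A_{l_k}'(P_{l_k}-P_{l_k}^0)A_{l_k}]$, and $P^0_{l_{k-1}}=(T^0_{l_{k-1}})'W_{l_{k-1}}^{-1}T^0_{l_{k-1}}$ (when $k-1\le N-d$). The quantities are computed backward in time; the condition $W>0$ is understood recursively, so that all inverses used are those of positive definite matrices already computed. $W_{l_t}$ is not defined for $t\ge N-d+1$; every term containing $W_{l_t}^{-1}$ with such $t$ is read as $0$. **Auxiliary matrices (for $d\ge2$).** $\delta^j_{l_N}=0$ for $j=1,\dots,d-1$, and for $k=N,\dots,1$: $$(\delta_{l_{k-1}}^1)'=\Lambda_{l_{k-1},l_k}[A_{l_k}'(P_{l_k}-P_{l_k}^0)B_{l_k}]-(T_{l_{k-1}}^0)'W_{l_{k-1}}^{-1}T_{l_{k-1}}^1,$$ $$(\delta_{l_{k-1}}^j)'=\Lambda_{l_{k-1},l_k}[A_{l_k}'(\delta_{l_k}^{j-1})']-(T_{l_{k-1}}^0)'W_{l_{k-1}}^{-1}T_{l_{k-1}}^j,\quad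 j=2,\dots,d-1,$$ $$(\alpha_{l_{k-1},l_{k-1}}^{d-1})'=(\delta_{l_{k-1}}^{d-1})',\qquad(\alpha_{l_{k-1},l_{k-j}}^{d-j})'=(\delta_{l_{k-1}}^{d-j})'-\sum_{s=1}^{j-1}(\alpha_{l_{k-1},l_{k-s}}^{d-s})'W_{l_{k-s-1}}^{-1}T_{l_{k-s-1}}^{d-j+s},\quad j=2,\dots,d-1,$$ whenever the time indices involved are nonnegative. Thus $\alpha^{d-j}_{l_{k-1},l_{k-j}}$ is an $m\times n$ matrix depending on $l_{k-j},\dots,l_{k-1}$.
   Formalization: The condition W_{l_{k-d}}>0 is required only for modes l_{k-d} with P(θ(k-d)=l_{k-d})>0, since the literal ''only if'' fails at modes of probability zero (e.g. B_l=0, R_l=0 at a mode never visited); uniqueness is almost sure. *)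

(* Defs.v *)
From HB Require Import structures.
From mathcomp Require Import all_boot all_order all_algebra.
From mathcomp Require Import all_classical all_reals all_analysis.

Set Implicit Arguments.
Unset Strict Implicit.
Unset Printing Implicit Defensive.

Import Order.TTheory GRing.Theory Num.Theory.

Local Open Scope classical_set_scope.
Local Open Scope ring_scope.

Definition qform (R : realType) (n : nat) (M : 'M[R]_n) (x : 'cV[R]_n) : R :=
  (x^T *m M *m x) 0 0.

Definition symmetric_mx (R : realType) (n : nat) (M : 'M[R]_n) : Prop :=
  M^T = M.

Definition posdef_mx (R : realType) (n : nat) (M : 'M[R]_n) : Prop :=
  symmetric_mx M /\ forall x : 'cV[R]_n, x != 0 -> 0 < qform M x.

Definition possemidef_mx (R : realType) (n : nat) (M : 'M[R]_n) : Prop :=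
  symmetric_mx M /\ forall x : 'cV[R]_n, 0 <= qform M x.

Section Chain.
Context {d : measure_display} {Omega : measurableType d} {R : realType}.
Variable P : probability Omega R.
Context {L : nat}.

(* The Markov property is written without dividing by the probability of the
   past, so that pasts of probability zero need no special treatment. *)
Definition markov_chain (lam : 'I_L -> 'I_L -> R)
    (theta : nat -> Omega -> 'I_L) : Prop :=
  [/\ forall k l, measurable (theta k @^-1` [set l]),
      forall i j, 0 <= lam i j,
      forall i, \sum_(j < L) lam i j = 1 &
      forall (k : nat) (l : nat -> 'I_L),
        P [set w | forall i, (i <= k.+1)%N -> theta i w = l i] =
        (P [set w | forall i, (i <= k)%N -> theta i w = l i]
         * (lam (l k) (l k.+1))%:E)%E].

(* A generating family of the sigma-algebra G_k of theta(0), ..., theta(k). *)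
Definition past (theta : nat -> Omega -> 'I_L) (k : nat) : set (set Omega) :=
  [set E | exists i l, (i <= k)%N /\ E = theta i @^-1` [set l]].

Definition past_measurable (theta : nat -> Omega -> 'I_L) (k n : nat)
    (X : Omega -> 'cV[R]_n) : Prop :=
  forall i : 'I_n,
    measurable_fun setT
      ((fun w => X w i 0) : g_sigma_algebraType (past theta k) -> R).

(* Y is a version of E[X | <<s G>>]. *)
Definition is_cond_exp (G : set (set Omega)) (X Y : Omega -> R) : Prop :=
  [/\ measurable_fun setT (Y : g_sigma_algebraType G -> R),
      P.-integrable setT (EFin \o Y) &
      forall E, <<s G >> E ->
        (\int[P]_(w in E) (Y w)%:E = \int[P]_(w in E) (X w)%:E)%E].

Definition cond_exp (G : set (set Omega)) (X : Omega -> R) : Omega -> R :=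
  xget (cst 0) [set Y | is_cond_exp G X Y].

Definition cond_exp_vec (n : nat) (G : set (set Omega))
    (X : Omega -> 'cV[R]_n) : Omega -> 'cV[R]_n :=
  fun w => \col_i cond_exp G (fun w' => X w' i 0) w.

End Chain.

Record mjls (R : realType) (L n m : nat) := MJLS {
  trans  : 'I_L -> 'I_L -> R;
  sysA   : nat -> 'I_L -> 'M[R]_n;
  sysB   : nat -> 'I_L -> 'M[R]_(n, m);
  costQ  : nat -> 'I_L -> 'M[R]_n;
  costR  : nat -> 'I_L -> 'M[R]_m;
  costP  : 'I_L -> 'M[R]_n;      (* terminal penalties P_l(N+1) *)
  x_init : 'cV[R]_n;
  u_init : int -> 'cV[R]_m       (* read at the times -d, ..., -1 only *)
}.

Section Control.
Context {disp : measure_display} {Omega : measurableType disp} {R : realType}.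
Variable P : probability Omega R.
Context {L n m : nat}.
Variables (S : mjls R L n m) (d N : nat) (theta : nat -> Omega -> 'I_L).

(* Only u 0, ..., u (N - d) matter: later values never enter the dynamics up
   to time N+1, nor the cost. *)
Implicit Types u v : nat -> Omega -> 'cV[R]_m.

Definition input u (t : int) (w : Omega) : 'cV[R]_m :=
  match t with Posz k => u k w | Negz _ => u_init S t end.

Fixpoint state u (k : nat) (w : Omega) : 'cV[R]_n :=
  if k is j.+1 then
    sysA S j (theta j w) *m state u j w
    + sysB S j (theta j w) *m input u (j%:Z - d%:Z) w
  else x_init S.

Definition cost u : \bar R :=
  ('E_P[fun w => (
     \sum_(0 <= k < N.+1) qform (costQ S k (theta k w)) (state u k w)
     + \sum_(d <= k < N.+1)
         qform (costR S k (theta k w)) (input u (k%:Z - d%:Z) w)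
     + qform (costP S (theta N.+1 w)) (state u N.+1 w))%R])%E.

Definition admissible u : Prop :=
  forall k, (k <= N - d)%N -> past_measurable theta k (u k).

Definition optimal u : Prop :=
  admissible u /\ forall v, admissible v -> (cost u <= cost v)%E.

Definition unique_optimal : Prop :=
  exists2 u, optimal u &
    forall v, optimal v ->
      forall k, (k <= N - d)%N -> {ae P, forall w, v k w = u k w}.

(* costate_rev u i is lambda_(N-i). *)
Fixpoint costate_rev u (i : nat) : Omega -> 'cV[R]_n :=
  if i is j.+1 then
    cond_exp_vec P (past theta (N - i)) (fun w =>
      (sysA S (N - j) (theta (N - j) w))^T *m costate_rev u j w
      + costQ S (N - j) (theta (N - j) w) *m state u (N - j) w)
  else
    cond_exp_vec P (past theta N) (fun w =>
      costP S (theta N.+1 w) *m state u N.+1 w).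

Definition costate u (t : nat) : Omega -> 'cV[R]_n := costate_rev u (N - t).

End Control.

Section Riccati.
Context {R : realType} {L n m : nat}.
(* A mode path: l t is the mode l_t at time t. *)
Implicit Types l : nat -> 'I_L.

Definition set_mode l (t : nat) (i : 'I_L) : nat -> 'I_L :=
  fun t' => if t' == t then i else l t'.

Fixpoint Lambda_iter (V : lmodType R) (lam : 'I_L -> 'I_L -> R) (s c : nat)
    (E : (nat -> 'I_L) -> V) l : V :=
  if c is c'.+1 then
    \sum_(i < L) lam (l s) i *:
       Lambda_iter lam s.+1 c' E (set_mode l s.+1 i)
  else E l.

(* Lambda_{l_s, l_t}[E]: the sums replace l_{s+1}, ..., l_t in E. *)
Definition Lambda (V : lmodType R) (lam : 'I_L -> 'I_L -> R) (s t : nat)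
    (E : (nat -> 'I_L) -> V) l : V := Lambda_iter lam s (t - s) E l.

(* A_{l_(i+c-1)} ... A_{l_i} *)
Fixpoint A_prod (A : nat -> 'I_L -> 'M[R]_n) l (i c : nat) : 'M[R]_n :=
  if c is c'.+1 then A (i + c')%N (l (i + c')%N) *m A_prod A l i c' else 1%:M.

Definition F_prod (A : nat -> 'I_L -> 'M[R]_n) l (t i : nat) : 'M[R]_n :=
  A_prod A l i (t.+1 - i).

(* T^0 is m x n whereas T^j is m x m for j >= 1, hence two fields. *)
Record riccati := Riccati {
  ric_W     : nat -> 'I_L -> 'M[R]_m;
  ric_T0    : nat -> 'I_L -> 'M[R]_(m, n);
  ric_T     : nat -> nat -> 'I_L -> 'M[R]_m;        (* T^j_{l_t}: j, t, l_t *)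
  ric_P     : nat -> 'I_L -> 'M[R]_n;
  ric_P0    : nat -> 'I_L -> 'M[R]_n;
  ric_delta : nat -> nat -> 'I_L -> 'M[R]_(m, n);   (* delta^j_{l_t} *)
  (* alpha^e_{l_t, l_t'}: e, t, t', and the whole mode path *)
  ric_alpha : nat -> nat -> nat -> (nat -> 'I_L) -> 'M[R]_(m, n)
}.

Variables (S : mjls R L n m) (d N : nat) (X : riccati).

(* Terms containing W_{l_t}^{-1} with t >= N-d+1 are read as 0. *)
Definition W_inv (t : nat) (i : 'I_L) : 'M[R]_m :=
  if (t <= N - d)%N then invmx (ric_W X t i) else 0.

Local Notation A := (sysA S).
Local Notation B := (sysB S).
Local Notation W := (ric_W X).
Local Notation T0 := (ric_T0 X).
Local Notation T := (ric_T X).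
Local Notation P := (ric_P X).
Local Notation P0 := (ric_P0 X).
Local Notation delta := (ric_delta X).
Local Notation alpha := (ric_alpha X).
Local Notation Lam := (Lambda (trans S)).
Local Notation F := (F_prod A).

(* invmx is total, so the equations determine all these matrices on the
   relevant times by backward recursion.  The value of W_{l_t}^{-1} for a
   singular W_{l_t} is junk: then either W_{l_t} > 0 already fails, or the mode
   l_t has probability zero at time t and gets weight zero in every Lambda-sum
   started from a mode of positive probability. *)
Record solves_cdre : Prop := SolvesCDRE {
  cdre_P_last : forall l,
    P N (l N) = Lam N N.+1 (fun l => costP S (l N.+1)) l;
  cdre_P0_last : forall i l, (i < d)%N -> P0 (N - i) (l (N - i)%N) = 0;
  cdre_T0_last : forall i l, (i < d)%N -> T0 (N - i) (l (N - i)%N) = 0;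
  cdre_T_last : forall i j l, (i < d)%N -> (1 <= j < d)%N ->
    T j (N - i) (l (N - i)%N) = 0;
  cdre_W : forall k l, (d <= k <= N)%N ->
    W (k - d) (l (k - d)%N) =
    Lam (k - d) k (fun l =>
      (B k (l k))^T *m (P k (l k) - P0 k (l k)) *m B k (l k)
      + costR S k (l k)) l
    - \sum_(1 <= s < d) Lam (k - d) (k - s) (fun l =>
        (T s (k - s) (l (k - s)%N))^T *m W_inv (k - s) (l (k - s)%N)
        *m T s (k - s) (l (k - s)%N)) l;
  cdre_T0 : forall k l, (d <= k <= N)%N ->
    T0 (k - d) (l (k - d)%N) =
    Lam (k - d) k (fun l =>
      (B k (l k))^T *m (P k (l k) - P0 k (l k)) *m F l k (k - d + 1)) l
    - \sum_(1 <= s < d) Lam (k - d) (k - s) (fun l =>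
        (T s (k - s) (l (k - s)%N))^T *m W_inv (k - s) (l (k - s)%N)
        *m T0 (k - s) (l (k - s)%N) *m F l (k - s) (k - d + 1)) l;
  cdre_T : forall k j l, (d <= k <= N)%N -> (1 <= j < d)%N ->
    T j (k - d) (l (k - d)%N) =
    Lam (k - d) k (fun l =>
      (B k (l k))^T *m (P k (l k) - P0 k (l k)) *m F l k (k - d + j + 1)
      *m B (k - d + j) (l (k - d + j)%N)) l
    - \sum_(1 <= s < (d - j).+1) Lam (k - d) (k - s) (fun l =>
        (T s (k - s) (l (k - s)%N))^T *m W_inv (k - s) (l (k - s)%N)
        *m T0 (k - s) (l (k - s)%N) *m F l (k - s) (k - d + j + 1)
        *m B (k - d + j) (l (k - d + j)%N)) l
    - \sum_((d - j).+1 <= s < d) Lam (k - d) (k - s) (fun l =>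
        (T s (k - s) (l (k - s)%N))^T *m W_inv (k - s) (l (k - s)%N)
        *m T (s - (d - j)) (k - s) (l (k - s)%N)) l;
  cdre_P : forall k l, (1 <= k <= N)%N ->
    P (k - 1) (l (k - 1)%N) =
    Lam (k - 1) k (fun l =>
      costQ S k (l k)
      + (A k (l k))^T *m (P k (l k) - P0 k (l k)) *m A k (l k)) l;
  cdre_P0 : forall k l, (1 <= k <= N)%N -> (k - 1 <= N - d)%N ->
    P0 (k - 1) (l (k - 1)%N) =
    (T0 (k - 1) (l (k - 1)%N))^T *m W_inv (k - 1) (l (k - 1)%N)
    *m T0 (k - 1) (l (k - 1)%N)
}.

Record solves_auxiliary : Prop := SolvesAuxiliary {
  aux_delta_last : forall j l, (1 <= j < d)%N -> delta j N (l N) = 0;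
  aux_delta1 : forall k l, (1 < d)%N -> (1 <= k <= N)%N ->
    (delta 1 (k - 1) (l (k - 1)%N))^T =
    Lam (k - 1) k (fun l =>
      (A k (l k))^T *m (P k (l k) - P0 k (l k)) *m B k (l k)) l
    - (T0 (k - 1) (l (k - 1)%N))^T *m W_inv (k - 1) (l (k - 1)%N)
      *m T 1 (k - 1) (l (k - 1)%N);
  aux_delta : forall k j l, (1 <= k <= N)%N -> (2 <= j < d)%N ->
    (delta j (k - 1) (l (k - 1)%N))^T =
    Lam (k - 1) k (fun l => (A k (l k))^T *m (delta (j - 1) k (l k))^T) l
    - (T0 (k - 1) (l (k - 1)%N))^T *m W_inv (k - 1) (l (k - 1)%N)
      *m T j (k - 1) (l (k - 1)%N);
  aux_alpha1 : forall k l, (1 < d)%N -> (1 <= k <= N)%N ->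
    (alpha (d - 1) (k - 1) (k - 1) l)^T
    = (delta (d - 1) (k - 1) (l (k - 1)%N))^T;
  aux_alpha : forall k j l, (1 <= k <= N)%N -> (2 <= j < d)%N -> (j <= k)%N ->
    (alpha (d - j) (k - 1) (k - j) l)^T =
    (delta (d - j) (k - 1) (l (k - 1)%N))^T
    - \sum_(1 <= s < j)
        (alpha (d - s) (k - 1) (k - s) l)^T
        *m W_inv (k - s - 1) (l (k - s - 1)%N)
        *m T (d - j + s) (k - s - 1) (l (k - s - 1)%N)
}.

End Riccati.

Arguments riccati : clear implicits.

(* Main.v *)
(** Everything observable is a function of the mode path, so conditional
    expectations given the past are the iterated sums [Lambda] along paths of
    positive probability.  After time t the cost-to-go, minimized over the inputs
    still to be chosen, is a quadratic form in x(t+1) and the inputs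
    v(t+1), ..., v(t+d-1) already on their way, where v(k) = u(k-d).  Its blocks
    obey a one-step recursion of which the delayed Riccati equation is the unrolled
    form, and completing the square gives

      J = const + sum_t E[(v(t+d) + W^-1 g_t)' W (v(t+d) + W^-1 g_t)],

    with g_t linear in the data known at time t.  The positivity of W thus makes
    v(t+d) = - W^-1 g_t the unique optimum, while a direction z with z'Wz <= 0 lets
    one move the control along z without loss.  Along the optimum the gradients
    of the cost-to-go have zero conditional expectation, which yields the costate,
    and the triangular recursion for alpha solves the feedback law backwards. *)

Require Import Defs.
From HB Require Import structures.
From mathcomp Require Import all_boot all_order all_algebra.
From mathcomp Require Import all_classical all_reals all_analysis.
From mathcomp Require Import measurable_realfun.
From mathcomp Require Import lra zify.

Set Implicit Arguments.
Unset Strict Implicit.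
Unset Printing Implicit Defensive.

Import Order.TTheory GRing.Theory Num.Theory.

Local Open Scope classical_set_scope.
Local Open Scope ring_scope.

(** * Iterated sums over mode paths *)

Section LambdaTheory.
Context {R : realType} {L : nat}.
Variable lam : 'I_L -> 'I_L -> R.
Implicit Types (l : nat -> 'I_L) (s t r : nat).

(** The obstacle is that nothing is known of [ric_W] at modes of probability zero, nor, while
    necessity is being proved, at the other ones; [invmx] of a singular matrix carries no
    information. The identities for the cost-to-go are therefore proved with [Winv] as just some
    symmetric matrix, for every control and on every path. In place of the completed square they
    contain [defect], which becomes a square only where W is positive definite. The exact cost of an
    arbitrary control is thus available before any positivity, and necessity can be proved backwards
    in time. The identities come from the gradients of the cost-to-go rather than from the form
    itself. Gradients are linear, their recursions serve the costate and the cost alike, and all of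
    them, except the one for the newly decided input, have as error term a multiple of the same
    residual, whose vanishing is the feedback law. *)

Definition agree t l l' := forall i, (i <= t)%N -> l i = l' i.

(** The path-level counterpart of measurability with respect to the sigma-algebra of the modes up to
    time t. *)
Definition adapted (V : Type) t (E : (nat -> 'I_L) -> V) :=
  forall l l', agree t l l' -> E l = E l'.

(* [l'] continues [l] after time [s], with possible transitions up to [t]. *)
Definition reach s t l l' :=
  agree s l l' /\ forall k, (s <= k < t)%N -> lam (l' k) (l' k.+1) != 0.

Lemma agree_sym t l l' : agree t l l' -> agree t l' l.
Proof. by move=> h i /h. Qed.

Lemma agree_trans t l1 l2 l3 : agree t l1 l2 -> agree t l2 l3 -> agree t l1 l3.
Proof. by move=> h1 h2 i hi; rewrite h1 // h2. Qed.

Lemma agreeW s t l l' : (s <= t)%N -> agree t l l' -> agree s l l'.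
Proof. by move=> st h i hi; apply: h; apply: leq_trans st. Qed.

Lemma agree_set_mode t l i s : (t < s)%N -> agree t l (set_mode l s i).
Proof. by move=> ts k kt; rewrite /set_mode; case: eqP => // ?; lia. Qed.

Lemma set_mode_eq l t i : set_mode l t i t = i.
Proof. by rewrite /set_mode eqxx. Qed.

Lemma set_mode_id l t : set_mode l t (l t) = l.
Proof. by apply/funext => k; rewrite /set_mode; case: eqP => // ->. Qed.

Lemma agree_set_modeS s t l l' i : (s <= t.+1)%N ->
  agree t l l' -> agree s (set_mode l t.+1 i) (set_mode l' t.+1 i).
Proof.
move=> st h k ks; rewrite /set_mode; case: eqP => // kt.
by apply: h; lia.
Qed.

Lemma adaptedW (V : Type) s t (E : (nat -> 'I_L) -> V) :
  (s <= t)%N -> adapted s E -> adapted t E.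
Proof. by move=> st h l l' /(agreeW st) /h. Qed.

Lemma adapted_mode (V : Type) s t (f : 'I_L -> V) : (s <= t)%N ->
  adapted t (fun l => f (l s)).
Proof. by move=> st l l' h; rewrite h. Qed.

Lemma adapted1 (U V : Type) t (f : U -> V) E :
  adapted t E -> adapted t (fun l => f (E l)).
Proof. by move=> h l l' /h ->. Qed.

Lemma adapted2 (U U' V : Type) t (f : U -> U' -> V) E E' :
  adapted t E -> adapted t E' -> adapted t (fun l => f (E l) (E' l)).
Proof. by move=> h h' l l' a; rewrite (h _ _ a) (h' _ _ a). Qed.

Lemma adapted_sum (V : nmodType) (I : Type) (rI : seq I) (Q : pred I) t
    (E : I -> (nat -> 'I_L) -> V) :
  (forall i, Q i -> adapted t (E i)) ->
  adapted t (fun l => \sum_(i <- rI | Q i) E i l).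
Proof. by move=> h l l' a; apply: eq_bigr => i Qi; apply: h. Qed.

Section Module.
Variable V : lmodType R.
Implicit Types E : (nat -> 'I_L) -> V.

Lemma Lambda_ge s t E l : (t <= s)%N -> Lambda lam s t E l = E l.
Proof. by move=> ts; rewrite /Lambda (eqP (_ : t - s == 0)%N). Qed.

Lemma LambdaS s t E l : (s < t)%N -> Lambda lam s t E l =
  \sum_i lam (l s) i *: Lambda lam s.+1 t E (set_mode l s.+1 i).
Proof. by move=> st; rewrite /Lambda subnS; case: (t - s)%N (subn_gt0 s t) => [|c]; rewrite st. Qed.

(** The base case covers every r >= t because [Lambda] from r to t is then the identity, by
    truncated subtraction. *)
Lemma downward_ind t (Q : nat -> Prop) :
  (forall r, (t <= r)%N -> Q r) ->
  (forall r, (r < t)%N -> Q r.+1 -> Q r) -> forall s, Q s.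
Proof.
move=> h0 h1; move=> s; have [c] := ubnP (t - s)%N.
elim: c s => // c IH s sc; have [/h0 //|st] := leqP t s.
by apply: h1 => //; apply: IH; lia.
Qed.

(** A transition of weight zero kills its summand. This is what makes the arbitrary values at null
    modes harmless. *)
Lemma Lambda_eq_reach s t E E' l :
  (forall l', reach s t l l' -> E l' = E' l') ->
  Lambda lam s t E l = Lambda lam s t E' l.
Proof.
move: l; apply: (@downward_ind t (fun s => forall l,
  (forall l', reach s t l l' -> E l' = E' l') -> _)) => [r tr l h|r rt IH l h].
  by rewrite !Lambda_ge // h //; split=> // k; lia.
rewrite !LambdaS //; apply: eq_bigr => i _.
have [->|nz] := eqVneq (lam (l r) i) 0; first by rewrite !scale0r.
congr (_ *: _); apply: IH => l' [ag tr]; apply: h; split.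
  apply: agree_trans (agree_set_mode l i (ltnSn r)) _; exact: agreeW ag.
move=> k /andP[rk kt]; have [kr|rk'] := leqP k r; last by apply: tr; rewrite rk' kt.
have -> : k = r by lia.
by rewrite -!ag // set_mode_eq -(agree_set_mode l i (ltnSn r)).
Qed.

Lemma Lambda_eq s t E E' l :
  (forall l', agree s l l' -> E l' = E' l') ->
  Lambda lam s t E l = Lambda lam s t E' l.
Proof. by move=> h; apply: Lambda_eq_reach => l' [/h]. Qed.

Lemma eq_Lambda s t E E' l : E =1 E' ->
  Lambda lam s t E l = Lambda lam s t E' l.
Proof. by move=> h; apply: Lambda_eq => l' _; apply: h. Qed.

(** The tower property of conditional expectations. *)
Lemma Lambda_trans s r t E l : (s <= r <= t)%N ->
  Lambda lam s t E l = Lambda lam s r (Lambda lam r t E) l.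
Proof.
move=> /andP[]; move: l; apply: (@downward_ind r (fun s => forall l,
  (s <= r)%N -> (r <= t)%N -> _)) => [k rk l kr rt|k kr IH l _ rt].
  have -> : k = r by lia.
  by rewrite [RHS]Lambda_ge.
rewrite LambdaS ?[RHS]LambdaS //; last by lia.
by apply: eq_bigr => i _; rewrite IH.
Qed.

Lemma LambdaD s t E E' l :
  Lambda lam s t (fun l => E l + E' l) l = Lambda lam s t E l + Lambda lam s t E' l.
Proof.
move: s l; apply: (@downward_ind t) => [k rk l|k kr IH l].
  by rewrite !Lambda_ge.
rewrite !LambdaS // -big_split; apply: eq_bigr => i _.
by rewrite IH scalerDr.
Qed.

Lemma Lambda_adapted s t E : (s <= t)%N -> adapted t E ->
  adapted s (Lambda lam s t E).
Proof.
move=> st hE; move: s st; apply: (@downward_ind t)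
  => [k tk kt|k kt IH _] l l' ag.
  by rewrite !Lambda_ge //; apply: hE; apply: agreeW ag; lia.
rewrite !LambdaS // (ag k) //; apply: eq_bigr => i _; congr (_ *: _).
by apply: IH => //; apply: agree_set_modeS.
Qed.

Lemma Lambda_id s t E l : (forall i, \sum_j lam i j = 1) -> adapted s E ->
  Lambda lam s t E l = E l.
Proof.
move=> sum1 hE; transitivity (Lambda lam s t (fun _ => E l) l).
  by apply: Lambda_eq => l' ag; apply: hE; apply: agree_sym.
move: (E l) => c {hE}.
move: s l; apply: (@downward_ind t) => [k rk l|k kr IH l].
  by rewrite !Lambda_ge.
rewrite LambdaS // -[RHS]scale1r -(sum1 (l k)) scaler_suml.
by apply: eq_bigr => i _; rewrite IH.
Qed.

End Module.

Lemma Lambda_linear (V W : lmodType R) (f : {linear V -> W}) s t E l :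
  Lambda lam s t (fun l => f (E l)) l = f (Lambda lam s t E l).
Proof.
move: s l; apply: (@downward_ind t) => [k rk l|k kr IH l].
  by rewrite !Lambda_ge.
rewrite !LambdaS // linear_sum; apply: eq_bigr => i _.
by rewrite IH linearZ.
Qed.

Section Module2.
Variable V : lmodType R.
Implicit Types E : (nat -> 'I_L) -> V.

Lemma Lambda0 s t l : Lambda lam s t (fun _ => 0 : V) l = 0.
Proof.
move: s l; apply: (@downward_ind t) => [k rk l|k kr IH l].
  by rewrite Lambda_ge.
by rewrite LambdaS // big1 // => i _; rewrite IH scaler0.
Qed.

Lemma LambdaN s t E l : Lambda lam s t (fun l => - E l) l = - Lambda lam s t E l.
Proof. exact: (Lambda_linear (@GRing.opp V)). Qed.

Lemma LambdaB s t E E' l :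
  Lambda lam s t (fun l => E l - E' l) l = Lambda lam s t E l - Lambda lam s t E' l.
Proof. by rewrite LambdaD LambdaN. Qed.

Lemma Lambda_sum (I : Type) (rI : seq I) (Q : pred I) s t
    (E : I -> (nat -> 'I_L) -> V) l :
  Lambda lam s t (fun l => \sum_(i <- rI | Q i) E i l) l =
  \sum_(i <- rI | Q i) Lambda lam s t (E i) l.
Proof.
elim: rI => [|i rI IH].
  by rewrite big_nil -[RHS](Lambda0 s t l); apply: eq_Lambda => l'; rewrite big_nil.
rewrite big_cons -IH; case: ifP => Qi; last first.
  by apply: eq_Lambda => l'; rewrite big_cons Qi.
by rewrite -LambdaD; apply: eq_Lambda => l'; rewrite big_cons Qi.
Qed.

End Module2.

Lemma Lambda_tr (p q : nat) s t (E : _ -> 'M[R]_(p, q)) l :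
  Lambda lam s t (fun l => (E l)^T) l = (Lambda lam s t E l)^T.
Proof. exact: (Lambda_linear (@trmx R p q)). Qed.

(** Taking out what is known at time s. *)
Lemma Lambda_mull (p q r : nat) s t C (E : _ -> 'M[R]_(q, r)) l :
  adapted s C ->
  Lambda lam s t (fun l => (C l : 'M[R]_(p, q)) *m E l) l = C l *m Lambda lam s t E l.
Proof.
move=> hC; rewrite -(Lambda_linear (mulmx (C l))).
by apply: Lambda_eq => l' ag; rewrite (hC _ _ ag).
Qed.

Lemma Lambda_mulr (p q r : nat) s t C (E : _ -> 'M[R]_(p, q)) l :
  adapted s C ->
  Lambda lam s t (fun l => E l *m (C l : 'M[R]_(q, r))) l = Lambda lam s t E l *m C l.
Proof.
move=> hC; rewrite -[RHS](Lambda_linear (mulmxr (C l))).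
by apply: Lambda_eq => l' ag; rewrite (hC _ _ ag).
Qed.

Lemma Lambda_entry (p q : nat) s t (E : _ -> 'M[R]_(p, q)) l i j :
  Lambda lam s t E l i j = Lambda lam s t (fun l => E l i j) l :> R^o.
Proof.
move: s l; apply: (@downward_ind t) => [k rk l|k kr IH l].
  by rewrite !Lambda_ge.
by rewrite !LambdaS // summxE; apply: eq_bigr => h _; rewrite mxE IH.
Qed.

Section Positivity.
Hypothesis lam_ge0 : forall i j, 0 <= lam i j.
Implicit Types f : (nat -> 'I_L) -> R^o.

Lemma Lambda_ge0 s t f l : (forall l', reach s t l l' -> 0 <= f l') ->
  0 <= Lambda lam s t f l :> R.
Proof.
move: s l; apply: (@downward_ind t) => [r tr l h|r rt IH l h].
  by rewrite !Lambda_ge // h //; split=> // k; lia.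
rewrite LambdaS //; apply: sumr_ge0 => i _.
have [->|nz] := eqVneq (lam (l r) i) 0; first by rewrite scale0r.
apply: mulr_ge0 => //; apply: IH => l' [ag tr]; apply: h; split.
  apply: agree_trans (agree_set_mode l i (ltnSn r)) _; exact: agreeW ag.
move=> k /andP[rk kt]; have [kr|rk'] := leqP k r; last by apply: tr; rewrite rk' kt.
have -> : k = r by lia.
by rewrite -!ag // set_mode_eq -(agree_set_mode l i (ltnSn r)).
Qed.

(** The given path supplies, at each step, one summand that is positive; the remaining ones are
    nonnegative. *)
Lemma Lambda_gt0 s t f l l' : adapted t f -> (s <= t)%N ->
  (forall l', reach s t l l' -> 0 <= f l') ->
  reach s t l l' -> 0 < f l' -> 0 < Lambda lam s t f l :> R.
Proof.
move=> hf + + l'l fl'; move: s l l'l; apply: (@downward_ind t) => [r tr l|r rt IH l].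
  case=> ag _ *; rewrite Lambda_ge // (hf l l') //; apply: agreeW ag; lia.
move=> rch _ h; rewrite LambdaS //.
have step i l'' : lam (l r) i != 0 -> reach r.+1 t (set_mode l r.+1 i) l'' -> reach r t l l''.
  move=> nz [ag tr]; split.
    apply: agree_trans (agree_set_mode l i (ltnSn r)) _; exact: agreeW ag.
  move=> k /andP[rk kt]; have [kr|rk'] := leqP k r; last by apply: tr; rewrite rk' kt.
  have -> : k = r by lia.
  by rewrite -!ag // set_mode_eq -(agree_set_mode l i (ltnSn r)).
have nz : lam (l r) (l' r.+1) != 0.
  by case: rch => ag /(_ r); rewrite ag //; apply; rewrite leqnn.
rewrite (bigD1 (l' r.+1)) //=; apply: ltr_pwDl.
  apply: mulr_gt0; first by rewrite lt_def nz lam_ge0.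
  apply: IH => // [|l'' /(step _ _ nz) /h //].
  case: rch => ag tr; split; last by move=> k kt; apply: tr; lia.
  move=> k kr; rewrite /set_mode; case: eqP => [->|neq] //.
  by apply: ag; lia.
apply: sumr_ge0 => i _; have [->|nzi] := eqVneq (lam (l r) i) 0; first by rewrite scale0r.
apply: mulr_ge0 => //; apply: Lambda_ge0 => l'' /(step _ _ nzi); exact: h.
Qed.

End Positivity.

End LambdaTheory.

(** * Expectation over mode paths *)

Section PathExpectation.
Context {R : realType} {L : nat}.
Variables (lam : 'I_L -> 'I_L -> R) (p0 : 'I_L -> R) (T : nat).
Hypothesis lam_ge0 : forall i j, 0 <= lam i j.
Hypothesis lam_sum1 : forall i, \sum_j lam i j = 1.
Hypothesis p0_ge0 : forall i, 0 <= p0 i.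
Implicit Types (l : nat -> 'I_L) (f g : (nat -> 'I_L) -> R) (s t : nat).

(** The constant path only fixes the mode at time 0: the iterated sum overwrites those at times 1,
    ..., T. *)
Definition EP f : R :=
  \sum_i p0 i * Lambda lam 0 T (f : _ -> R^o) (fun=> i).

(* The paths of positive probability: nothing is known of [ric_W] off them. *)
Definition charged t l :=
  p0 (l 0) != 0 /\ forall k, (k < t)%N -> lam (l k) (l k.+1) != 0.

Lemma chargedW s t l : (s <= t)%N -> charged t l -> charged s l.
Proof. by move=> st [h0 h]; split=> // k ks; apply: h; apply: leq_trans st. Qed.

Lemma charged_reach t l i : p0 i != 0 -> reach lam 0 t (fun=> i) l -> charged t l.
Proof. by move=> pi [ag tr]; split; [rewrite -ag|move=> k kt; apply: tr]. Qed.

Lemma reach_charged s t l l' : charged s l -> reach lam s t l l' -> charged t l'.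
Proof.
move=> [h0 h] [ag tr]; split; first by rewrite -ag.
move=> k kt; have [ks|sk] := ltnP k s; last by apply: tr; rewrite sk.
by rewrite -!ag ?h // ltnW.
Qed.

Lemma charged_agree t l l' : agree t l l' -> charged t l -> charged t l'.
Proof. by move=> ag h; apply: reach_charged h _; split=> // k; lia. Qed.

(** Each row of [lam] sums to 1, so some next mode has nonzero weight. *)
Lemma charged_ext s t l : (s <= t)%N -> charged s l ->
  exists2 l', agree s l l' & charged t l'.
Proof.
move=> /subnK <-; elim: (t - s)%N => [|c IH] h; first by exists l.
have [l' ag ch] := IH h.
have [i nz] : exists i, lam (l' (c + s)%N) i != 0.
  apply/existsP; apply: contraT => /existsPn z.
  have := lam_sum1 (l' (c + s)%N); rewrite big1 => [/eqP|i _]; first by rewrite eq_sym oner_eq0.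
  by have := z i; rewrite negbK => /eqP.
have ag' := agree_set_mode l' i (ltnSn (c + s)).
exists (set_mode l' (c + s).+1 i).
  by apply: agree_trans ag _; apply: agreeW ag'; lia.
have [h0 h1] := charged_agree ag' ch.
split=> // k; rewrite addSn ltnS leq_eqVlt => /orP[/eqP ->|]; last exact: h1.
by rewrite set_mode_eq -ag'.
Qed.

Lemma EP_eq f g : (forall l, charged T l -> f l = g l) -> EP f = EP g.
Proof.
move=> h; apply: eq_bigr => i _; have [->|nz] := eqVneq (p0 i) 0.
  by rewrite !mul0r.
by congr (_ * _); apply: Lambda_eq_reach => l /charged_reach -/(_ nz); exact: h.
Qed.

Lemma eq_EP f g : f =1 g -> EP f = EP g.
Proof. by move=> h; apply: EP_eq => l _; apply: h. Qed.

Lemma EPD f g : EP (fun l => f l + g l) = EP f + EP g.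
Proof.
by rewrite -big_split /=; apply: eq_bigr => i _; rewrite -mulrDr (LambdaD lam).
Qed.

Lemma EPZ c f : EP (fun l => c * f l) = c * EP f.
Proof.
rewrite mulr_sumr; apply: eq_bigr => i _; rewrite mulrCA; congr (_ * _).
exact: (Lambda_linear lam ( *:%R c : {linear R^o -> R^o}) 0 T f).
Qed.

Lemma EPN f : EP (fun l => - f l) = - EP f.
Proof. by rewrite -mulN1r -EPZ; apply: eq_EP => l; rewrite mulN1r. Qed.

Lemma EP0 : EP (fun=> 0) = 0.
Proof. by rewrite -[RHS](mul0r (EP (fun=> 0))) -EPZ; apply: eq_EP => l; rewrite mul0r. Qed.

Lemma EP_sum (I : Type) (rI : seq I) (Q : pred I) (f : I -> (nat -> 'I_L) -> R) :
  EP (fun l => \sum_(i <- rI | Q i) f i l) = \sum_(i <- rI | Q i) EP (f i).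
Proof.
elim: rI => [|i rI IH].
  by rewrite big_nil -[RHS]EP0; apply: eq_EP => l; rewrite big_nil.
rewrite big_cons -IH; case: ifP => Qi; last first.
  by apply: eq_EP => l; rewrite big_cons Qi.
by rewrite -EPD; apply: eq_EP => l; rewrite big_cons Qi.
Qed.

Lemma Lambda0_adapted t (f : _ -> R^o) l : (t <= T)%N -> adapted t f ->
  Lambda lam 0 T f l = Lambda lam 0 t f l.
Proof.
move=> tT ft; rewrite (@Lambda_trans _ _ _ _ 0 t) //.
by apply: eq_Lambda => l'; apply: Lambda_id.
Qed.

Lemma EP_Lambda s t f : (s <= t <= T)%N -> adapted t f ->
  EP (Lambda lam s t (f : _ -> R^o)) = EP f.
Proof.
move=> /andP[st tT] ft; apply: eq_bigr => i _; congr (_ * _).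
rewrite (Lambda0_adapted _ tT ft) (Lambda0_adapted _ (leq_trans st tT)).
  by rewrite -Lambda_trans.
exact: Lambda_adapted.
Qed.

Lemma EP_ge0 f : (forall l, charged T l -> 0 <= f l) -> 0 <= EP f.
Proof.
move=> h; apply: sumr_ge0 => i _; have [->|nz] := eqVneq (p0 i) 0.
  by rewrite mul0r.
apply: mulr_ge0 => //; apply: Lambda_ge0 => // l /charged_reach -/(_ nz); exact: h.
Qed.

Lemma EP_gt0 f l : adapted T f -> (forall l, charged T l -> 0 <= f l) ->
  charged T l -> 0 < f l -> 0 < EP f.
Proof.
move=> fT h [h0 ch] fl; rewrite /EP (bigD1 (l 0)) //=; apply: ltr_pwDl.
  apply: mulr_gt0; first by rewrite lt_def h0 p0_ge0.
  apply: (@Lambda_gt0 _ _ _ lam_ge0 0 T _ _ l) => // [l' /charged_reach -/(_ h0)|].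
    exact: h.
  by split=> // i; rewrite leqn0 => /eqP ->.
apply: sumr_ge0 => i _; have [->|nz] := eqVneq (p0 i) 0; first by rewrite mul0r.
apply: mulr_ge0 => //; apply: Lambda_ge0 => // l' /charged_reach -/(_ nz); exact: h.
Qed.

(** The conclusion is pointwise because each charged path carries positive weight. *)
Lemma EP_eq0 f l : adapted T f -> (forall l, charged T l -> 0 <= f l) ->
  EP f = 0 -> charged T l -> f l = 0.
Proof.
move=> fT h f0 ch; apply/eqP; rewrite eq_le h // andbT leNgt; apply/negP => fl.
by have := EP_gt0 fT h ch fl; rewrite f0 ltxx.
Qed.

End PathExpectation.

(** * The Riccati equation as a one-step recursion *)

Section OneStep.
Context {R : realType} {L n m : nat}.
Variables (S : mjls R L n m) (d N : nat) (X : riccati R L n m).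
Hypotheses (hd : (0 < d)%N) (hN : (d < N)%N).
Hypothesis trans_sum1 : forall i, \sum_j trans S i j = 1.
Hypothesis hQ : forall k l, (k <= N)%N -> possemidef_mx (costQ S k l).
Hypothesis hR : forall k l, (d <= k <= N)%N -> possemidef_mx (costR S k l).
Hypothesis hP : forall l, symmetric_mx (costP S l).
Hypotheses (hX : solves_cdre S d N X) (hX' : solves_auxiliary S d N X).
Implicit Types (l : nat -> 'I_L) (i j k r s t : nat).

Local Notation Lam := (Lambda (trans S)).

Definition A_ t l := sysA S t (l t).
Definition B_ t l := sysB S t (l t).
Definition Q_ t l := costQ S t (l t).
(* The cost charges the inputs v(k) = u(k-d) from time [d] on only. *)
Definition R_ t l := if (d <= t)%N then costR S t (l t) else 0.
Definition W_ t l := ric_W X t (l t).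
Definition Winv t l := W_inv d N X t (l t).
Definition T0_ t l := ric_T0 X t (l t).
Definition T_ j t l := ric_T X j t (l t).
Definition Pd t l := ric_P X t (l t) - ric_P0 X t (l t).

(** The value at j = 0 is chosen so that the separate equation for delta^1 becomes the first
    instance of a single recursion, [D_step]. *)
Definition D_ j t l : 'M[R]_(m, n) :=
  if j is 0 then (B_ t l)^T *m Pd t l else ric_delta X j t (l t).

(* The cost-to-go after time [t] is a quadratic form in x(t+1) and the inputs
   v(t+1), ..., v(t+d-1) already decided upon, where v(k) = u(k-d).  [Pd], [D_]
   and [M_] are its blocks; [M_ 0 j] includes the pending input v(t) as well. *)
Fixpoint M_ i j t l : 'M[R]_m :=
  match i, j with
  | 0, 0 => D_ 0 t l *m B_ t l + R_ t l
  | i'.+1, 0 => D_ i t l *m B_ t l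
  | 0, j'.+1 => (D_ j t l *m B_ t l)^T
  | i'.+1, j'.+1 =>
      if (t < N)%N then
        Lam t t.+1 (M_ i' j' t.+1) l - (T_ i t l)^T *m Winv t l *m T_ j t l
      else 0
  end.

Lemma adapted_A t : adapted t (A_ t). Proof. exact: adapted_mode. Qed.
Lemma adapted_B t : adapted t (B_ t). Proof. exact: adapted_mode. Qed.
Lemma adapted_W t : adapted t (W_ t). Proof. exact: adapted_mode. Qed.
Lemma adapted_Winv t : adapted t (Winv t). Proof. exact: adapted_mode. Qed.
Lemma adapted_T0 t : adapted t (T0_ t). Proof. exact: adapted_mode. Qed.
Lemma adapted_T j t : adapted t (T_ j t). Proof. exact: adapted_mode. Qed.
Lemma adapted_Pd t : adapted t (Pd t).
Proof. by move=> l l' h; rewrite /Pd h. Qed.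
Lemma adapted_R t : adapted t (R_ t).
Proof. by move=> l l' h; rewrite /R_ h. Qed.
Lemma adapted_D j t : adapted t (D_ j t).
Proof. by move=> l l' h; case: j => [|j]; rewrite /= /B_ /Pd h. Qed.

Lemma adapted_M i j t : adapted t (M_ i j t).
Proof.
elim: i j t => [|i IH] [|j] t l l' h /=; rewrite /B_ /Pd /R_ /T_ /Winv ?h //.
case: ifP => // tN; congr (_ - _).
by apply: Lambda_adapted h => //; apply: IH.
Qed.

Lemma T_late t l : (N - d < t <= N)%N ->
  T0_ t l = 0 /\ forall j, (1 <= j < d)%N -> T_ j t l = 0.
Proof.
move=> tN; rewrite /T0_ /T_.
have id : (N - t < d)%N by lia.
have Nt : (N - (N - t) = t)%N by lia.
split=> [|j jd]; first by have := cdre_T0_last hX l id; rewrite Nt.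
by have := cdre_T_last hX l id jd; rewrite Nt.
Qed.

Lemma Winv_late t l : (N - d < t)%N -> Winv t l = 0.
Proof. by move=> tN; rewrite /Winv /W_inv leqNgt tN. Qed.

Lemma P0E t l : (t <= N)%N ->
  ric_P0 X t (l t) = (T0_ t l)^T *m Winv t l *m T0_ t l.
Proof.
move=> tN; have [tNd|tNd] := leqP t (N - d).
  have := @cdre_P0 _ _ _ _ _ _ _ _ hX t.+1 l; rewrite subSS subn0; apply; lia.
have [-> _] := @T_late t l (introT andP (conj tNd tN)).
have id : (N - t < d)%N by lia.
by have := cdre_P0_last hX l id; rewrite subKn // mulmx0.
Qed.

Lemma P_step t l : (t < N)%N -> ric_P X t (l t) =
  Lam t t.+1 (fun l => Q_ t.+1 l + (A_ t.+1 l)^T *m Pd t.+1 l *m A_ t.+1 l) l.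
Proof. by move=> tN; have := @cdre_P _ _ _ _ _ _ _ _ hX t.+1 l; rewrite subSS subn0; apply; lia. Qed.

(** Each step of the recursion is substituted into the previous one, and the tower property
    collapses the nested expectations. With c = d this produces the sums over s of the delayed
    Riccati equation. *)
Lemma unroll (V : lmodType R) t c (f h : nat -> (nat -> 'I_L) -> V) l :
  (0 < c)%N ->
  (forall r l, (0 < r < c)%N ->
     f r l = Lam (t + r) (t + r).+1 (f r.+1) l - h r l) ->
  Lam t t.+1 (f 1) l =
  Lam t (t + c) (f c) l - \sum_(1 <= r < c) Lam t (t + r) (h r) l.
Proof.
elim: c => // -[_ _ _|c IH _ fh]; first by rewrite addn1 big_geq // subr0.
rewrite IH // => [|r l' rc]; last by apply: fh; lia.
rewrite [in RHS]big_nat_recr //= opprD.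
rewrite addrCA addrC; congr (_ - _).
rewrite [X in _ = X - _](@Lambda_trans _ _ _ _ t (t + c.+1)); last by lia.
rewrite ?addnS.
by rewrite -LambdaB; apply: eq_Lambda => l'; rewrite -addnS fh ?ltnSn.
Qed.

Lemma M_step i j t l : (t < N)%N -> M_ i.+1 j.+1 t l =
  Lam t t.+1 (M_ i j t.+1) l - (T_ i.+1 t l)^T *m Winv t l *m T_ j.+1 t l.
Proof. by move=> /= ->. Qed.

(** [unroll] counts steps r upwards from time t, whereas the Riccati sums count s = d - r back from
    t + d. *)
Lemma sum_rev1 (V : nmodType) c (f : nat -> V) :
  \sum_(1 <= s < c) f s = \sum_(1 <= s < c) f (c - s)%N.
Proof.
rewrite big_nat_rev /=; apply: eq_big_nat => s _.
by rewrite add1n subSS.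
Qed.

(* [ric_W] and, below, [ric_T0] and [ric_T] are one-step expectations of the blocks:
   the sums over s in their defining equations undo the recursions of [M_] and [D_]. *)
Lemma W_Lam t l : (t <= N - d)%N ->
  W_ t l = Lam t t.+1 (M_ (d - 1) (d - 1) t.+1) l.
Proof.
move=> tN.
(* [f r] is the diagonal block of the input v(t+d) seen from time t + r; at r = d this input is the
   pending one and the block is [M_ 0 0]. *)
pose f r := M_ (d - r) (d - r) (t + r).
pose h r l := (T_ (d - r) (t + r) l)^T *m Winv (t + r) l *m T_ (d - r) (t + r) l.
transitivity (Lam t t.+1 (f 1) l); last by rewrite /f addn1.
rewrite (@unroll _ t d f h) // => [|r l' rd]; last first.
  rewrite /f /h (_ : (d - r = (d - r.+1).+1)%N); last by lia.
  by rewrite M_step ?addnS //; lia.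
have := @cdre_W _ _ _ _ _ _ _ _ hX (t + d)%N l.
rewrite addnK -/(W_ t l) => ->; last by lia.
congr (_ - _).
  apply: eq_Lambda => l'; rewrite /f subnn /= /R_ ifT //; last by lia.
rewrite sum_rev1; apply: eq_big_nat => s sd.
by rewrite /h (_ : (t + d - (d - s) = t + s)%N) //; lia.
Qed.

Lemma Lam_sym (p : nat) s t (E : (nat -> 'I_L) -> 'M[R]_p) l :
  (forall l, (E l)^T = E l) -> (Lam s t E l)^T = Lam s t E l.
Proof. by move=> h; rewrite -Lambda_tr; apply: eq_Lambda. Qed.

(** The four claims need a joint backward induction: W comes from the blocks at t + 1, [Winv] from
    W, [Pd] from [Winv] through P^0, and the blocks at t from all of these. *)
Lemma sym_all t : (t <= N)%N -> forall l,
  [/\ (Pd t l)^T = Pd t l, (Winv t l)^T = Winv t l,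
     (t <= N - d)%N -> (W_ t l)^T = W_ t l &
     forall i j, (M_ i j t l)^T = M_ j i t l].
Proof.
move: t; apply: (@downward_ind N.+1) => [t Nt tN|t]; first by lia.
rewrite ltnS => tN0 IH tN l.
have hW : (t <= N - d)%N -> (W_ t l)^T = W_ t l.
  move=> tNd; rewrite W_Lam //; apply: Lam_sym => l'.
  have tN' : (t.+1 <= N)%N by lia.
  by case: (IH tN' l') => _ _ _ ->.
have hWinv : (Winv t l)^T = Winv t l.
  rewrite /Winv /W_inv; case: ifP => tNd; last by rewrite trmx0.
  by rewrite trmx_inv [X in invmx X]hW.
have hPd : (Pd t l)^T = Pd t l.
  rewrite /Pd linearB /=; congr (_ - _); last first.
    by rewrite P0E // !trmx_mul trmxK hWinv mulmxA.
  have [tN'|tN'] := ltnP t N; last first.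
    have -> : t = N by lia.
    by rewrite (cdre_P_last hX); apply: Lam_sym => l'; exact: hP.
  rewrite P_step //; apply: Lam_sym => l'; have [hPd _ _ _] := IH tN' l'.
  rewrite linearD /= !trmx_mul trmxK hPd mulmxA; congr (_ + _).
  by case: (hQ (l' t.+1) tN').
split=> // i j.
have hR' : (R_ t l)^T = R_ t l.
  rewrite /R_; case: ifP => dt; last by rewrite trmx0.
  by have [] : possemidef_mx (costR S t (l t)) by apply: hR; rewrite dt.
move: i j => [|i] [|j] //=; rewrite ?trmxK //.
  by rewrite linearD /= hR' !trmx_mul trmxK hPd mulmxA.
case: ifP => tN'; last by rewrite trmx0.
rewrite linearB /= !trmx_mul trmxK hWinv mulmxA; congr (_ - _).
by rewrite -Lambda_tr; apply: eq_Lambda => l'; case: (IH tN' l').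
Qed.

(** The equations for delta are stated for transposes, so this form rests on the symmetry of [Pd]
    and [Winv]. *)
Lemma D_step j t l : (t < N)%N -> (j.+1 < d)%N -> D_ j.+1 t l =
  Lam t t.+1 (fun l => D_ j t.+1 l *m A_ t.+1 l) l
  - (T_ j.+1 t l)^T *m Winv t l *m T0_ t l.
Proof.
move=> tN jd; have [_ hW _ _] := sym_all (ltnW tN) l.
apply: trmx_inj; rewrite linearB /= !trmx_mul trmxK hW mulmxA -Lambda_tr.
case: j jd => [|j] jd.
  have := @aux_delta1 _ _ _ _ _ _ _ _ hX' t.+1 l; rewrite subSS subn0 => -> //.
  congr (_ - _); apply: eq_Lambda => l' /=.
  by have [hPd _ _ _] := sym_all tN l'; rewrite !trmx_mul trmxK hPd mulmxA.
have := @aux_delta _ _ _ _ _ _ _ _ hX' t.+1 j.+2 l; rewrite !subSS !subn0 => -> //; try lia.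
by congr (_ - _); apply: eq_Lambda => l'; rewrite trmx_mul.
Qed.

Lemma F_recl s t l : (s <= t)%N ->
  F_prod (sysA S) l t.+1 s.+1 = A_ t.+1 l *m F_prod (sysA S) l t s.+1.
Proof.
move=> st; rewrite /F_prod (_ : t.+2 - s.+1 = (t - s).+1)%N /=; last by lia.
by rewrite /A_ subSS (_ : (s.+1 + (t - s) = t.+1)%N) //; lia.
Qed.

Lemma F_refl t l : F_prod (sysA S) l t t.+1 = 1%:M.
Proof. by rewrite /F_prod subnn. Qed.

Lemma adapted_F r t s : (t <= r)%N -> adapted r (fun l => F_prod (sysA S) l t s.+1).
Proof.
move=> tr l l' h; rewrite /F_prod subSS.
have : (s.+1 + (t - s) <= r.+1)%N \/ (t - s = 0)%N by lia.
elim: (t - s)%N => [|c IH] //= hc.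
by rewrite h ?IH //; lia.
Qed.

Lemma T0_Lam t l : (t <= N - d)%N ->
  T0_ t l = Lam t t.+1 (fun l => D_ (d - 1) t.+1 l *m A_ t.+1 l) l.
Proof.
move=> tN.
(* The product F carries x(t+1) to time t + r + 1 under the dynamics without input, where [D_] acts
   on it. *)
pose f r l := D_ (d - r) (t + r) l *m F_prod (sysA S) l (t + r) t.+1.
pose h r l := (T_ (d - r) (t + r) l)^T *m Winv (t + r) l *m T0_ (t + r) l
  *m F_prod (sysA S) l (t + r) t.+1.
transitivity (Lam t t.+1 (f 1) l); last first.
  apply: eq_Lambda => l'; rewrite /f addn1 F_recl // F_refl mulmx1 //.
rewrite (@unroll _ t d f h) // => [|r l' rd]; last first.
  rewrite /f /h (_ : (d - r = (d - r.+1).+1)%N); last by lia.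
  rewrite D_step; try lia.
  rewrite mulmxBl -(@Lambda_mulr _ _ _ _ _ _ _ _ (fun l => F_prod (sysA S) l (t + r) t.+1)); last exact: adapted_F.
  congr (_ - _); apply: eq_Lambda => l2.
  by rewrite addnS F_recl ?mulmxA //; lia.
have := @cdre_T0 _ _ _ _ _ _ _ _ hX (t + d)%N l.
rewrite addnK -/(T0_ t l) => ->; last by lia.
congr (_ - _).
  by apply: eq_Lambda => l'; rewrite /f subnn addn1.
rewrite sum_rev1; apply: eq_big_nat => s sd.
by rewrite /h (_ : (t + d - (d - s) = t + s)%N) ?addn1 //; lia.
Qed.

(** The input v(t+j+1) changes role at its own time. Until then it is a variable of the cost-to-go
    and follows the recursion of [M_]; afterwards it is part of the state, carried on by [FB], and
    follows that of [D_]. The two regimes meet in [M_] with second index 0, which is [D_] times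
    [B_], and they are the two sums in the equation for T^j. *)
Lemma T_Lam j t l : (t <= N - d)%N -> (j.+1 < d)%N ->
  T_ j.+1 t l = Lam t t.+1 (M_ (d - 1) j t.+1) l.
Proof.
move=> tN jd.
pose FB r l := F_prod (sysA S) l (t + r) (t + j.+1).+1 *m B_ (t + j.+1) l.
pose f r l := if (r <= j.+1)%N then M_ (d - r) (j.+1 - r) (t + r) l
  else D_ (d - r) (t + r) l *m FB r l.
pose h r l := (T_ (d - r) (t + r) l)^T *m Winv (t + r) l *m
  (if (r < j.+1)%N then T_ (j.+1 - r) (t + r) l else T0_ (t + r) l *m FB r l).
transitivity (Lam t t.+1 (f 1) l); last first.
  by apply: eq_Lambda => l'; rewrite /f addn1 subSS subn0.
rewrite (@unroll _ t d f h) // => [|r l' rd]; last first.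
  rewrite /f /h.
  have [rj|jr|jr] := ltngtP r j.+1.
  - rewrite (_ : (d - r = (d - r.+1).+1)%N); last by lia.
    rewrite (_ : (j.+1 - r = (j.+1 - r.+1).+1)%N); last by lia.
    by rewrite M_step ?addnS //; lia.
  - rewrite (_ : (d - r = (d - r.+1).+1)%N); last by lia.
    rewrite D_step; try lia.
    rewrite mulmxBl -(@Lambda_mulr _ _ _ _ _ _ _ _ (FB r)); last first.
      apply: adapted2; first exact: adapted_F.
      by apply: (adaptedW _ (@adapted_B _)); lia.
    rewrite mulmxA; congr (_ - _); apply: eq_Lambda => l2.
    by rewrite /FB (addnS t r) F_recl ?mulmxA //; lia.
  - rewrite jr subnn (_ : (d - j.+1 = (d - j.+2).+1)%N); last by lia.
    transitivity (D_ (d - j.+2).+1 (t + j.+1) l' *m B_ (t + j.+1) l') => //.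
    rewrite D_step; try lia.
    rewrite mulmxBl -(@Lambda_mulr _ _ _ _ _ _ _ _ (B_ (t + j.+1))); last exact: adapted_B.
    rewrite /FB F_refl mul1mx mulmxA; congr (_ - _); apply: eq_Lambda => l2.
    by rewrite (addnS t j.+1) F_recl ?F_refl ?mulmx1 ?mulmxA.
have := @cdre_T _ _ _ _ _ _ _ _ hX (t + d)%N j.+1 l.
rewrite addnK -/(T_ j.+1 t l) => ->; try lia.
rewrite -addrA -opprD; congr (_ - _).
  apply: eq_Lambda => l'; rewrite /f subnn leqNgt jd /=.
  by rewrite /FB !addnS addn0 !mulmxA.
rewrite [in RHS]sum_rev1 [in RHS](big_cat_nat (n := (d - j.+1).+1)) //=; try lia.
have ts s : (1 <= s < d)%N -> (t + d - s = t + (d - s))%N /\ (d - (d - s) = s)%N by lia.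
congr (_ + _); apply: eq_big_nat => s sd; have [|-> dds] := ts s; try by lia.
  rewrite /h dds /FB ltnNge (_ : (j.+1 <= d - s)%N) /=; last by lia.
  by apply: eq_Lambda => l'; rewrite !addn1 !addnS !mulmxA.
rewrite /h dds (_ : (d - s < j.+1)%N); last by lia.
by apply: eq_Lambda => l'; rewrite (_ : (j.+1 - (d - s) = s - (d - j.+1))%N) //; lia.
Qed.

Lemma sum_ord_recl (V : nmodType) c (F : nat -> V) : (0 < c)%N ->
  \sum_(i < c) F i = F 0 + \sum_(i < c.-1) F i.+1.
Proof. by case: c => // c _; rewrite big_ord_recl. Qed.

Lemma sum_ord_recr (V : nmodType) c (F : nat -> V) : (0 < c)%N ->
  \sum_(i < c) F i = \sum_(i < c.-1) F i + F c.-1.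
Proof. by case: c => // c _; rewrite big_ord_recr. Qed.

(** * Trajectories and completion of the square *)

Section Trajectory.
(* [v k] is the input u(k-d) that acts at time [k]; it is decided upon at time k-d. *)
Variable v : nat -> (nat -> 'I_L) -> 'cV[R]_m.
Hypothesis va : forall k, adapted (k - d) (v k).

Fixpoint xs k l : 'cV[R]_n :=
  if k is k'.+1 then A_ k' l *m xs k' l + B_ k' l *m v k' l else x_init S.

Lemma xsS k l : xs k.+1 l = A_ k l *m xs k l + B_ k l *m v k l.
Proof. by []. Qed.

Arguments xs : simpl never.

Lemma adapted_xs k : adapted k (xs k.+1).
Proof.
elim: k => [|k IH] l l' h; rewrite xsS [RHS]xsS (adapted_A h) (adapted_B h).
  by rewrite (va (l' := l')) //; apply: agreeW h; lia.
rewrite (va (l' := l')); last by apply: agreeW h; lia.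
by rewrite (IH l l') //; apply: agreeW h.
Qed.

Lemma adapted_v t i : (i < d)%N -> adapted t (v (t + i.+1)).
Proof. by move=> id; apply: (adaptedW _ (@va _)); lia. Qed.

(* Half the gradient of the cost-to-go in v(t+j), without the inputs after v(t+c). *)
Definition grad j c t l : 'cV[R]_m :=
  D_ j t l *m xs t.+1 l + \sum_(i < c) M_ j i.+1 t l *m v (t + i.+1) l
  + (if j is 0 then R_ t l *m v t l else 0).

(* For c = d-1, minimizing over v(t+d) = u(t) amounts to [gain + W_t v(t+d) = 0];
   smaller [c] drop the inputs after v(t+c). *)
Definition gain c t l : 'cV[R]_m :=
  T0_ t l *m xs t.+1 l + \sum_(i < c) T_ i.+1 t l *m v (t + i.+1) l.

(** Half the gradient of the cost-to-go in x(t+1); along the optimum it is the costate at time t. *)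
Definition costate_form t l : 'cV[R]_n :=
  Pd t l *m xs t.+1 l + \sum_(i < d.-1) (D_ i.+1 t l)^T *m v (t + i.+1) l.

(** Substituting the dynamics for x(t+2) splits off a term in the pending input v(t+1). Together
    with R when j = 0, its coefficient is the block [M_ j 0], which becomes the summand i = 0. *)
Lemma gradS j c t l : grad j c t.+1 l =
  D_ j t.+1 l *m A_ t.+1 l *m xs t.+1 l
  + \sum_(i < c.+1) M_ j i t.+1 l *m v (t + i.+1) l.
Proof.
rewrite /grad (xsS t.+1) mulmxDr !mulmxA -!addrA; congr (_ + _).
rewrite big_ord_recl addn1 /=.
under [in RHS]eq_bigr do rewrite /bump /= add1n addnS.
case: j => [|j] /=; last by rewrite addr0.
by rewrite mulmxDl addrAC addrA.
Qed.

Lemma Lam_gradS j c t l : (c < d)%N -> Lam t t.+1 (grad j c t.+1) l =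
  Lam t t.+1 (fun l => D_ j t.+1 l *m A_ t.+1 l) l *m xs t.+1 l
  + \sum_(i < c.+1) Lam t t.+1 (M_ j i t.+1) l *m v (t + i.+1) l.
Proof.
move=> cd; rewrite (eq_Lambda _ _ _ _ (gradS j c t)) LambdaD Lambda_sum.
rewrite Lambda_mulr; last exact: adapted_xs.
congr (_ + _); apply: eq_bigr => i _.
by rewrite Lambda_mulr //; apply: adapted_v; rewrite (leq_trans (ltn_ord i)).
Qed.

Lemma Lam_M_step i j t l : (t < N)%N -> Lam t t.+1 (M_ i j t.+1) l =
  M_ i.+1 j.+1 t l + (T_ i.+1 t l)^T *m Winv t l *m T_ j.+1 t l.
Proof. by move=> tN; rewrite M_step // subrK. Qed.

Lemma Lam_D_step j t l : (t < N)%N -> (j.+1 < d)%N ->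
  Lam t t.+1 (fun l => D_ j t.+1 l *m A_ t.+1 l) l =
  D_ j.+1 t l + (T_ j.+1 t l)^T *m Winv t l *m T0_ t l.
Proof. by move=> tN jd; rewrite D_step // subrK. Qed.

Lemma Lam_grad_trunc j c t l : (t < N)%N -> (j.+1 < d)%N -> (c < d)%N ->
  Lam t t.+1 (grad j c t.+1) l =
  grad j.+1 c.+1 t l + (T_ j.+1 t l)^T *m (Winv t l *m gain c.+1 t l).
Proof.
move=> tN jd cd; rewrite Lam_gradS // Lam_D_step // /grad /gain addr0.
under eq_bigr do rewrite Lam_M_step // mulmxDl.
rewrite big_split /= mulmxDl !mulmxDr !mulmx_sumr !mulmxA addrACA.
by congr (_ + (_ + _)); apply: eq_bigr => i _; rewrite !mulmxA.
Qed.

Lemma Lam_grad_last_trunc c t l : (t <= N - d)%N -> (c.+1 < d)%N ->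
  Lam t t.+1 (grad (d - 1) c t.+1) l = gain c.+1 t l.
Proof.
move=> tN cd; rewrite Lam_gradS; last by lia.
rewrite -T0_Lam //; congr (_ + _); apply: eq_bigr => i _.
by rewrite T_Lam //; have := ltn_ord i; lia.
Qed.

(** The half derivative, projected on time t, in the one input decided at time t; equating it to
    zero is the first-order condition. *)
Lemma Lam_grad_last t l : (t <= N - d)%N ->
  Lam t t.+1 (grad (d - 1) (d - 1) t.+1) l =
  gain (d - 1) t l + W_ t l *m v (t + d) l.
Proof.
move=> tN; rewrite Lam_gradS; last by lia.
rewrite big_ord_recr /= -T0_Lam // -W_Lam // (_ : (d - 1).+1 = d)%N; last by lia.
rewrite addrA; congr (_ + _ + _); apply: eq_bigr => i _.
by rewrite T_Lam //; have := ltn_ord i; lia.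
Qed.

Hypothesis v_late : forall k l, (N < k)%N -> v k l = 0.

Lemma Lam_grad j t l : (t < N)%N -> (j.+1 < d)%N ->
  Lam t t.+1 (grad j (d - 1) t.+1) l =
  grad j.+1 (d - 1) t l
  + (T_ j.+1 t l)^T *m (Winv t l *m gain (d - 1) t l + v (t + d) l).
Proof.
move=> tN jd; rewrite Lam_gradS; last by lia.
have dE : (d - 1 = (d - 2).+1)%N by lia.
have := @Lam_grad_trunc j (d - 2) t l tN jd; rewrite Lam_gradS -?dE; last by lia.
move=> h; rewrite big_ord_recr /= addrA h ?mulmxDr; last by lia.
rewrite -addrA; congr (_ + (_ + _)).
rewrite (_ : (d - 1).+1 = d)%N; last by lia.
have [tNd|tNd] := leqP t (N - d); last by rewrite v_late ?mulmx0 //; lia.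
(* The coefficient of v(t+d) is a block transposed to the one that [T_Lam] computes, so symmetry is
   needed here. *)
rewrite T_Lam // -Lambda_tr; congr (_ *m _).
by apply: eq_Lambda => l'; have [_ _ _ ->] := sym_all tN l'.
Qed.

Lemma BT_costate_form t l : (t <= N)%N ->
  (B_ t l)^T *m costate_form t l + R_ t l *m v t l = grad 0 (d - 1) t l.
Proof.
move=> tN; rewrite /grad /costate_form subn1; congr (_ + _).
rewrite mulmxDr mulmxA mulmx_sumr; congr (_ + _).
by apply: eq_bigr => i _; rewrite /= trmx_mul mulmxA.
Qed.

Lemma costate_formS t l : (t < N)%N ->
  (A_ t.+1 l)^T *m costate_form t.+1 l + Q_ t.+1 l *m xs t.+1 l =
  (Q_ t.+1 l + (A_ t.+1 l)^T *m Pd t.+1 l *m A_ t.+1 l) *m xs t.+1 l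
  + \sum_(i < d) (D_ i t.+1 l *m A_ t.+1 l)^T *m v (t + i.+1) l.
Proof.
move=> tN; rewrite /costate_form (xsS t.+1).
have := sum_ord_recl (fun i => (D_ i t.+1 l *m A_ t.+1 l)^T *m v (t + i.+1) l) hd; cbv beta => ->.
have [hPd _ _ _] := sym_all tN l.
rewrite [D_ 0 _ _]/=.
move: (Pd t.+1 l) (xs t.+1 l) hPd => p x hp.

rewrite !mulmxDr [in RHS]mulmxDl !mulmxA [LHS]addrC -!addrA; congr (_ + (_ + _)).
rewrite !trmx_mul trmxK hp addn1 /= mulmxA; congr (_ + _).
rewrite mulmx_sumr; apply: eq_bigr => i _.
by rewrite addSnnS trmx_mul mulmxA.
Qed.

(** The costate equation holds for every control up to a multiple of the feedback residual [Winv]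
    gain + v(t+d). The term P^0 subtracted in [Pd] is absorbed by that residual. *)
Lemma Lam_costate_form t l : (t < N)%N ->
  Lam t t.+1 (fun l => (A_ t.+1 l)^T *m costate_form t.+1 l + Q_ t.+1 l *m xs t.+1 l) l =
  costate_form t l + (T0_ t l)^T *m (Winv t l *m gain (d - 1) t l + v (t + d) l).
Proof.
move=> tN; rewrite (eq_Lambda _ _ _ _ (fun l => costate_formS l tN)) LambdaD.
rewrite Lambda_mulr; last exact: adapted_xs.
rewrite -P_step // Lambda_sum.
have [_ hW _ _] := sym_all (ltnW tN) l.
rewrite (_ : ric_P X t (l t) = Pd t l + (T0_ t l)^T *m Winv t l *m T0_ t l); last first.
  by rewrite /Pd -P0E ?subrK // ltnW.
transitivity ((Pd t l + (T0_ t l)^T *m Winv t l *m T0_ t l) *m xs t.+1 l +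
  (\sum_(i < d.-1) ((D_ i.+1 t l)^T *m v (t + i.+1) l
     + (T0_ t l)^T *m Winv t l *m T_ i.+1 t l *m v (t + i.+1) l)
   + (T0_ t l)^T *m v (t + d) l)); last first.
  rewrite /costate_form /gain subn1 big_split /=; move: (Pd t l) (xs t.+1 l) => p x.
  rewrite mulmxDl !mulmxDr !mulmxA !mulmx_sumr -!addrA; congr (_ + _).
  rewrite addrCA; congr (_ + (_ + (_ + _))).
  by apply: eq_bigr => i _; rewrite !mulmxA.
have dE : (d = d.-1.+1)%N by lia.
congr (_ + _).
have := sum_ord_recr (fun i => Lam t t.+1 (fun l =>
  (D_ i t.+1 l *m A_ t.+1 l)^T *m v (t + i.+1) l) l) hd; cbv beta => ->.
rewrite -dE; congr (_ + _).
  apply: eq_bigr => i _; have id : (i.+1 < d)%N by have := ltn_ord i; lia.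
  rewrite (@Lambda_mulr _ _ _ _ _ _ _ _ (v (t + i.+1))); last first.
    by apply: adapted_v; exact: ltnW.
  by rewrite Lambda_tr Lam_D_step // linearD /= !trmx_mul trmxK hW mulmxDl !mulmxA.
rewrite (@Lambda_mulr _ _ _ _ _ _ _ _ (v (t + d))); last first.
  by apply: (adaptedW _ (@va _)); lia.
have [tNd|tNd] := leqP t (N - d); last by rewrite v_late ?mulmx0 //; lia.
by rewrite T0_Lam // Lambda_tr subn1.
Qed.

(** The quadratic cost-to-go written, by Euler's identity, as the pairing of its variables with
    their half gradients, so that the recursions of the gradients yield its own. *)
Definition value_form t l : 'M[R]_1 :=
  (xs t.+1 l)^T *m costate_form t l
  + \sum_(i < d.-1) (v (t + i.+1) l)^T *m grad i.+1 (d - 1) t l.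

(** The completed square of v(t+d) + W^-1 gain, expanded so that [Winv] need not be an inverse of
    W. *)
Definition defect t l : 'M[R]_1 :=
  (gain (d - 1) t l)^T *m (Winv t l *m gain (d - 1) t l + v (t + d) l)
  + (v (t + d) l)^T *m (gain (d - 1) t l + W_ t l *m v (t + d) l).

Lemma value_form_cost t l : (t < N)%N ->
  value_form t.+1 l + (xs t.+1 l)^T *m Q_ t.+1 l *m xs t.+1 l
  + (v t.+1 l)^T *m R_ t.+1 l *m v t.+1 l =
  (xs t.+1 l)^T *m ((A_ t.+1 l)^T *m costate_form t.+1 l + Q_ t.+1 l *m xs t.+1 l)
  + \sum_(i < d) (v (t + i.+1) l)^T *m grad i (d - 1) t.+1 l.
Proof.
move=> tN.
have := sum_ord_recl (fun i => (v (t + i.+1) l)^T *m grad i (d - 1) t.+1 l) hd; cbv beta => ->.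
rewrite addn1 -BT_costate_form // /value_form (xsS t.+1).
have -> : (A_ t.+1 l *m xs t.+1 l + B_ t.+1 l *m v t.+1 l)^T =
    (xs t.+1 l)^T *m (A_ t.+1 l)^T + (v t.+1 l)^T *m (B_ t.+1 l)^T.
  by rewrite linearD /= !trmx_mul.
under [in RHS]eq_bigr do rewrite -addSnnS.
move: (costate_form t.+1 l) (xs t.+1 l) (\sum_(_ < _) _) => p x s.
by rewrite mulmxDl !mulmxDr !mulmxA [LHS](AC (3*1*1) ((1*4)*((2*5)*3))).
Qed.

(** One step of dynamic programming for an arbitrary control, without positivity: [defect] is what
    the decision v(t+d) adds to the minimal cost once W is positive. *)
Lemma Lam_value_form t l : (t < N)%N ->
  Lam t t.+1 (fun l => value_form t.+1 l + (xs t.+1 l)^T *m Q_ t.+1 l *m xs t.+1 l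
    + (v t.+1 l)^T *m R_ t.+1 l *m v t.+1 l) l =
  value_form t l + (if (t <= N - d)%N then defect t l else 0).
Proof.
move=> tN; rewrite (eq_Lambda _ _ _ _ (fun l => value_form_cost l tN)) LambdaD Lambda_sum.
rewrite Lambda_mull; last by apply: adapted1; exact: adapted_xs.
rewrite Lam_costate_form //.
have dE : (d = d.-1.+1)%N by lia.
set u := v (t + d) l; set g := gain (d - 1) t l.
transitivity ((xs t.+1 l)^T *m (costate_form t l + (T0_ t l)^T *m (Winv t l *m g + u))
  + (\sum_(i < d.-1) ((v (t + i.+1) l)^T *m grad i.+1 (d - 1) t l
     + (v (t + i.+1) l)^T *m (T_ i.+1 t l)^T *m (Winv t l *m g + u))
   + (if (t <= N - d)%N then u^T *m (g + W_ t l *m u) else 0))).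
  congr (_ + _).
have := sum_ord_recr (fun i => Lam t t.+1 (fun l =>
    (v (t + i.+1) l)^T *m grad i (d - 1) t.+1 l) l) hd; cbv beta => ->.
  rewrite -dE; congr (_ + _).
    apply: eq_bigr => i _; have id : (i.+1 < d)%N by have := ltn_ord i; lia.
    rewrite (@Lambda_mull _ _ _ _ _ _ _ _ (fun l => (v (t + i.+1) l)^T)).
      rewrite Lam_grad // -/g -/u; move: (grad i.+1 _ t l) (_ *m g + u) => z y.
      by rewrite mulmxDr mulmxA.
    by apply: adapted1; apply: adapted_v; exact: ltnW.
  rewrite (@Lambda_mull _ _ _ _ _ _ _ _ (fun l => (v (t + d) l)^T)); last first.
    by apply: adapted1; apply: (adaptedW _ (@va _)); lia.
  rewrite -/u; have [tNd|tNd] := leqP t (N - d).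
    by rewrite -subn1 Lam_grad_last.
  by rewrite /u v_late ?trmx0 ?mul0mx //; lia.
(* The recursions of the gradients leave multiples of the common residual; their coefficients add up
   to the transposed gain. *)
have gE : g^T = (xs t.+1 l)^T *m (T0_ t l)^T
    + \sum_(i < d.-1) (v (t + i.+1) l)^T *m (T_ i.+1 t l)^T.
  rewrite /g /gain subn1 linearD /= trmx_mul; congr (_ + _).
  by rewrite raddf_sum /=; apply: eq_bigr => i _; rewrite trmx_mul.
transitivity (value_form t l + (g^T *m (Winv t l *m g + u)
   + (if (t <= N - d)%N then u^T *m (g + W_ t l *m u) else 0))).
  rewrite gE big_split /value_form; move: (costate_form t l) (xs t.+1 l) (Winv t l *m g + u) => p x y.
  move: (if _ then _ else _) => c /=.
  by rewrite mulmxDr mulmxDl mulmx_suml mulmxA [LHS](AC (2*(2*1)) ((1*3)*((2*4)*5))).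
congr (_ + _); rewrite /defect -/g -/u; case: leqP => // tNd.
by rewrite /u v_late ?Winv_late //; [rewrite !(mul0mx, mulmx0, addr0)|lia].
Qed.

End Trajectory.

(** * Optimal controls and feedback *)

Variables (p0 : 'I_L -> R) (u0 : nat -> 'cV[R]_m).
Hypothesis trans_ge0 : forall i j : 'I_L, 0 <= trans S i j.
Hypothesis p0_ge0 : forall i : 'I_L, 0 <= p0 i.
Implicit Types v : nat -> (nat -> 'I_L) -> 'cV[R]_m.

Local Notation Ex := (EP (trans S) p0 N.+1).
Local Notation charged := (charged (trans S) p0).

(** Setting the inputs after time N to zero, which affects neither the state up to N + 1 nor the
    cost, makes all terms in v(t+d) with t > N - d vanish, in accordance with [Winv] being 0
    there. *)
Definition control v :=
  [/\ forall k, adapted (k - d) (v k),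
      forall k l, (N < k)%N -> v k l = 0 &
      forall k l, (k < d)%N -> v k l = u0 k].

Definition running v k l : 'M[R]_1 :=
  (xs v k l)^T *m Q_ k l *m xs v k l + (v k l)^T *m R_ k l *m v k l.

Definition path_cost v l : R :=
  \sum_(0 <= k < N.+1) qform (costQ S k (l k)) (xs v k l)
  + \sum_(d <= k < N.+1) qform (costR S k (l k)) (v k l)
  + qform (costP S (l N.+1)) (xs v N.+1 l).

Definition pcost v := Ex (path_cost v).

Definition poptimal v := control v /\ forall v', control v' -> pcost v <= pcost v'.

Lemma xs_ext v v' k l : (forall i, (i < k)%N -> v i l = v' i l) ->
  xs v k l = xs v' k l.
Proof.
elim: k => // k IH h; rewrite !xsS h // IH // => i ik; apply: h; exact: ltnW.
Qed.

Lemma gain_ext v v' c t l : (c < d)%N ->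
  (forall k, (k < t + d)%N -> v k l = v' k l) -> gain v c t l = gain v' c t l.
Proof.
move=> cd h; rewrite /gain (@xs_ext v v') => [|i it]; last by apply: h; lia.
by congr (_ + _); apply: eq_bigr => i _; rewrite h //; have := ltn_ord i; lia.
Qed.

Lemma defect_ext v v' t l : (forall k, (k <= t + d)%N -> v k l = v' k l) ->
  defect v t l = defect v' t l.
Proof.
move=> h; rewrite /defect (@gain_ext v v'); last by move=> k kt; apply: h; exact: ltnW.
  by rewrite h.
by lia.
Qed.

Lemma base_ext v v' l : (forall k, (k < d)%N -> v k l = v' k l) ->
  value_form v 0 l + running v 0 l = value_form v' 0 l + running v' 0 l.
Proof.
move=> h; have xE : xs v 1 l = xs v' 1 l.
  by apply: xs_ext => i i1; apply: h; lia.
rewrite /value_form /running /costate_form /grad xE h //; congr (_ + _ + (_ + _)).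
  by congr (_ *m (_ + _)); apply: eq_bigr => i _; rewrite h //; have := ltn_ord i; lia.
apply: eq_bigr => i _; rewrite h; last by have := ltn_ord i; lia.
congr (_ *m (_ + _ + _)); apply: eq_bigr => j _.
by rewrite h //; have := ltn_ord j; lia.
Qed.

Lemma adapted_gain v c t : (forall k, adapted (k - d) (v k)) -> (c < d)%N ->
  adapted t (gain v c t).
Proof.
move=> va cd; apply: adapted2.
  by apply: adapted2; [exact: adapted_T0|exact: adapted_xs].
apply: adapted_sum => i _; apply: adapted2; first exact: adapted_T.
by apply: adapted_v => //; have := ltn_ord i; lia.
Qed.

Lemma adapted_defect v t : (forall k, adapted (k - d) (v k)) -> adapted t (defect v t).
Proof.
move=> va; have vt : adapted t (v (t + d)) by apply: (adaptedW _ (@va _)); lia.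
have gt : adapted t (gain v (d - 1) t) by apply: adapted_gain => //; lia.
by move=> l l' ag; rewrite /defect (vt _ _ ag) (gt _ _ ag) (adapted_W ag) (adapted_Winv ag).
Qed.

Lemma value_form_last v l : (forall k l, (N < k)%N -> v k l = 0) ->
  value_form v N l = (xs v N.+1 l)^T *m ric_P X N (l N) *m xs v N.+1 l.
Proof.
move=> v_late; rewrite /value_form big1 ?addr0 => [|i _]; last first.
  by rewrite v_late ?trmx0 ?mul0mx // ; lia.
rewrite /costate_form big1 ?addr0 => [|i _]; last by rewrite v_late ?mulmx0 //; lia.
rewrite /Pd P0E // (@T_late N l _).1; last by lia.
by rewrite mulmx0 subr0 mulmxA.
Qed.

Lemma Ex_scalar s t (f : (nat -> 'I_L) -> 'M[R]_1) : (s <= t <= N.+1)%N ->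
  adapted t f -> Ex (fun l => Lam s t f l 0 0) = Ex (fun l => f l 0 0).
Proof.
move=> st ft.
rewrite -(@EP_Lambda _ _ _ p0 N.+1 trans_sum1 s t (fun l => f l 0 0)) //; last first.
  by move=> l l' /ft ->.
by apply: eq_EP => l; rewrite Lambda_entry.
Qed.

Lemma adapted_xsW v k : (forall k, adapted (k - d) (v k)) -> adapted k (xs v k).
Proof. by move=> va; case: k => // k; apply: adaptedW (leqnSn k) (@adapted_xs v va k). Qed.

Lemma adapted_running v k : (forall k, adapted (k - d) (v k)) ->
  adapted k (running v k).
Proof.
move=> va l l' ag; rewrite /running (adapted_xsW va ag) (adapted_R ag) /Q_ ag //.
by rewrite (va _ _ l') //; apply: agreeW ag; lia.
Qed.

Lemma adapted_value_form v t : (forall k, adapted (k - d) (v k)) -> adapted t (value_form v t).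
Proof.
move=> va; have vt i : (i < d.-1)%N -> adapted t (v (t + i.+1)).
  by move=> id; apply: adapted_v => //; lia.
move=> l l' ag; rewrite /value_form /costate_form /grad (adapted_xs va ag) (adapted_Pd ag).
congr (_ *m (_ + _) + _).
  by apply: eq_bigr => i _; rewrite (vt _ _ _ _ ag) ?(adapted_D _ ag).
apply: eq_bigr => i _; rewrite (vt _ _ _ _ ag) // (adapted_D _ ag).
congr (_ *m (_ + _ + _)); apply: eq_bigr => j _.
by rewrite (adapted_M _ _ ag) (vt _ _ _ _ ag) //; have := ltn_ord j; lia.
Qed.

Lemma Ex_value_form_step v t : control v -> (t < N)%N ->
  Ex (fun l => (value_form v t.+1 l) 0 0) + Ex (fun l => (running v t.+1 l) 0 0) =
  Ex (fun l => (value_form v t l) 0 0)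
  + (if (t <= N - d)%N then Ex (fun l => (defect v t l) 0 0) else 0).
Proof.
move=> [va v_late _] tN.
have aV := @adapted_value_form v t.+1 va; have ar := @adapted_running v t.+1 va.
transitivity (Ex (fun l => (value_form v t.+1 l + running v t.+1 l) 0 0)).
  by rewrite -EPD; apply: eq_EP => l; rewrite [RHS]mxE.
rewrite -(@Ex_scalar t t.+1 (fun l => value_form v t.+1 l + running v t.+1 l)); last by move=> l l' ag; rewrite (aV _ _ ag) (ar _ _ ag).
  transitivity (Ex (fun l => (value_form v t l + (if (t <= N - d)%N then defect v t l else 0)) 0 0)).
    apply: eq_EP => l; rewrite -Lam_value_form //; congr (fun_of_matrix _ 0 0).
    by apply: eq_Lambda => l'; rewrite addrA.
  case: ifP => _; last by rewrite addr0; apply: eq_EP => l; rewrite addr0.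
  by rewrite -EPD; apply: eq_EP => l; rewrite [LHS]mxE.
by lia.
Qed.

(** Telescoping of the one-step identity. The first term involves only the prescribed inputs v(0),
    ..., v(d-1), hence it is common to all controls. *)
Lemma pcostE v : control v ->
  pcost v = Ex (fun l => (value_form v 0 l + running v 0 l) 0 0)
    + \sum_(t < (N - d).+1) Ex (fun l => (defect v t l) 0 0).
Proof.
move=> cv; have [va v_late _] := cv.
transitivity (Ex (fun l => (value_form v N l) 0 0)
    + \sum_(0 <= k < N.+1) Ex (fun l => (running v k l) 0 0)).
  rewrite -EP_sum -EPD.
  transitivity (Ex (fun l => Lam N N.+1 (fun l =>
     (xs v N.+1 l)^T *m costP S (l N.+1) *m xs v N.+1 l) l 0 0
     + \sum_(0 <= k < N.+1) (running v k l) 0 0)); last first.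
    apply: eq_EP => l; congr (_ + _); rewrite value_form_last //.
    have ax := @adapted_xs v va N.
    rewrite (Lambda_mulr _ _ _ _ ax) (@Lambda_mull _ _ _ _ _ _ _ _ (fun l => (xs v N.+1 l)^T)).
      by rewrite (cdre_P_last hX).
    exact: adapted1.
  rewrite EPD Ex_scalar -?EPD; last 2 first.
  - by lia.
  - have ax := adaptedW (leqnSn N) (@adapted_xs v va N).
    by move=> l l' ag; rewrite (ax _ _ ag) ag.
  apply: eq_EP => l; rewrite /path_cost addrC; congr (_ + _).
  transitivity (\sum_(0 <= k < N.+1) qform (costQ S k (l k)) (xs v k l)
    + \sum_(0 <= k < N.+1) qform (R_ k l) (v k l)).
    congr (_ + _); rewrite [RHS](big_cat_nat (n := d)) //=; last by lia.
    have -> : \sum_(0 <= k < d) qform (R_ k l) (v k l) = 0.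
      rewrite big_nat big1 // => k kd.
      by rewrite /R_ leqNgt (andP kd).2 /qform mulmx0 mul0mx mxE.
    rewrite add0r.
    by apply: eq_big_nat => k kd; rewrite /R_ ifT //; lia.
  by rewrite -big_split; apply: eq_bigr => k _; rewrite /= /running mxE.
rewrite big_nat_recl //=.
have tel t : (t <= N)%N -> Ex (fun l => (value_form v t l) 0 0)
   + \sum_(0 <= k < t) Ex (fun l => (running v k.+1 l) 0 0) =
   Ex (fun l => (value_form v 0 l) 0 0)
   + \sum_(0 <= k < t) (if (k <= N - d)%N then Ex (fun l => (defect v k l) 0 0) else 0).
  elim: t => [_|t IH tN]; first by rewrite !big_geq.
  rewrite !big_nat_recr //=; move: (IH (ltnW tN)) (Ex_value_form_step cv tN).
  do 2!move: (\sum_(_ <= _ < _) _) => ?.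
  move: (EP _ _ _ _) (EP _ _ _ _) (EP _ _ _ _) (EP _ _ _ _) (if _ then _ else _) => ? ? ? ? ?.
  lra.
rewrite addrCA tel // [RHS](_ : _ = Ex (fun l => (running v 0 l) 0 0) +
  (Ex (fun l => (value_form v 0 l) 0 0) + \sum_(t < (N - d).+1) Ex (fun l => (defect v t l) 0 0))).
  congr (_ + (_ + _)); rewrite (big_cat_nat (n := (N - d).+1)) //=; last by lia.
  rewrite big_mkord [X in _ + X]big_nat [X in _ + X]big1 ?addr0 => [|k kN].
    by apply: eq_bigr => i _; rewrite -ltnS ltn_ord.
  by rewrite leqNgt (_ : (N - d < k)%N) //; lia.
rewrite addrA; congr (_ + _).
by rewrite addrC -EPD; apply: eq_EP => l; rewrite [LHS]mxE.
Qed.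

(** * Completing the square and the feedback law *)

Definition feedback v t l := v (t + d)%N l = - (Winv t l *m gain v (d - 1) t l).

Lemma posdef_unit p (M : 'M[R]_p) : posdef_mx M -> M \in unitmx.
Proof.
move=> [_ pos]; rewrite -row_free_unit -kermx_eq0; apply/eqP/row_matrixP => i.
rewrite row0; apply/eqP; apply: contraT => nz.
have := pos (row i (kermx M))^T; rewrite /qform trmxK -[_ *m M]row_mul mulmx_ker row0.
rewrite mul0mx mxE ltxx; apply.
by apply: contra nz => /eqP h; rewrite -(trmxK (row _ _)) h trmx0.
Qed.

Lemma defect_posdef v t l : (t <= N - d)%N -> posdef_mx (W_ t l) ->
  (defect v t l) 0 0 = qform (W_ t l) (v (t + d)%N l + Winv t l *m gain v (d - 1) t l).
Proof.
move=> tN pos; have [sW _] := pos; have uW := posdef_unit pos.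
have WiE : Winv t l = invmx (W_ t l) by rewrite /Winv /W_inv tN.
have sWi : (Winv t l)^T = Winv t l by rewrite WiE trmx_inv sW.
rewrite /defect /qform; move: (gain _ _ _ _) (v _ _) => g u.
congr (fun_of_matrix _ 0 0).
have -> : (u + Winv t l *m g)^T = u^T + g^T *m Winv t l.
  by rewrite linearD /= trmx_mul sWi.
rewrite !mulmxDl !mulmxDr.
rewrite -!mulmxA ![W_ t l *m (Winv t l *m _)]mulmxA WiE (mulmxV uW) mul1mx.
rewrite ![invmx _ *m (W_ t l *m _)]mulmxA (mulVmx uW) mul1mx.
by rewrite [LHS](AC (2*2) ((4*3)*(2*1))).
Qed.

Lemma defect_ge0 v t l : (t <= N - d)%N -> posdef_mx (W_ t l) -> 0 <= (defect v t l) 0 0.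
Proof.
move=> tN pos; rewrite defect_posdef //; have [_ h] := pos.
move: (v _ _ + _) => y; have [->|/h/ltW //] := eqVneq y 0.
by rewrite /qform mulmx0 mxE.
Qed.

Lemma defect_eq0 v t l : (t <= N - d)%N -> posdef_mx (W_ t l) ->
  (defect v t l) 0 0 = 0 <-> feedback v t l.
Proof.
move=> tN pos; rewrite defect_posdef // /feedback; have [_ h] := pos; split=> [q0|->].
  apply/eqP; rewrite -addr_eq0; apply: contraT => /h.
  by rewrite q0 ltxx.
by rewrite addNr /qform mulmx0 mxE.
Qed.

Definition feedback_step v r k l :=
  if k == (r + d)%N then - (Winv r l *m gain v (d - 1) r l) else v k l.

(** The law at time r reads only inputs before r + d, so overwriting at increasing times s, ..., s +
    c - 1 never disturbs the law already imposed. The start s is free so that the law can be resumed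
    after a perturbation. *)
Fixpoint feedback_from v s c : nat -> (nat -> 'I_L) -> 'cV[R]_m :=
  if c is c'.+1 then feedback_step (feedback_from v s c') (s + c') else v.

Lemma feedback_step_control v r : (r <= N - d)%N -> control v ->
  control (feedback_step v r).
Proof.
move=> rN [va vl vi]; split=> [k|k l kN|k l kd]; rewrite /feedback_step.
- case: eqP => [->|_]; last exact: va.
  have gr : adapted r (gain v (d - 1) r) by apply: adapted_gain => //; lia.
  by rewrite addnK => l l' ag; rewrite (adapted_Winv ag) (gr _ _ ag).
- by rewrite ifF ?vl //; lia.
- by rewrite ifF ?vi //; lia.
Qed.

Lemma feedback_from_control v s c : (s + c <= (N - d).+1)%N -> control v ->
  control (feedback_from v s c).
Proof.
move=> + cv; elim: c => // c IH sc; apply: feedback_step_control; first by lia.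
by apply: IH; lia.
Qed.

Lemma feedback_from_early v s c k l : (k < s + d)%N -> feedback_from v s c k l = v k l.
Proof.
move=> ks; elim: c => // c IH; rewrite /= /feedback_step ifF ?IH //; lia.
Qed.

Lemma feedback_fromP v s c r l : (s <= r < s + c)%N ->
  feedback (feedback_from v s c) r l.
Proof.
rewrite /feedback; elim: c => [|c IH] rc; first by lia.
have gE : gain (feedback_from v s c.+1) (d - 1) r l = gain (feedback_from v s c) (d - 1) r l.
  apply: gain_ext => [|k kr]; first by lia.
  by rewrite /= /feedback_step ifF //; lia.
rewrite gE /= /feedback_step eqn_add2r; case: eqP => [->|/eqP neq] //.
by apply: IH; lia.
Qed.

Definition W_pos_on t := forall l, charged t l -> posdef_mx (W_ t l).

Definition pbase v := Ex (fun l => (value_form v 0 l + running v 0 l) 0 0).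

Lemma pbase_eq v v' : control v -> control v' -> pbase v = pbase v'.
Proof.
move=> [_ _ h] [_ _ h']; apply: eq_EP => l; rewrite (@base_ext v v') // => k kd.
by rewrite h // h'.
Qed.

Lemma Ex_defect_ge0 v t : (t <= N - d)%N -> W_pos_on t -> 0 <= Ex (fun l => (defect v t l) 0 0).
Proof.
move=> tN wp; apply: EP_ge0 => // l ch; apply: defect_ge0 => //; apply: wp.
by apply: chargedW ch; lia.
Qed.

Lemma Ex_defect_eq0 v t : (t <= N - d)%N -> W_pos_on t ->
  (forall l, charged t l -> feedback v t l) -> Ex (fun l => (defect v t l) 0 0) = 0.
Proof.
move=> tN wp fb; rewrite -[RHS](EP0 (trans S) p0 N.+1); apply: EP_eq => l ch.
have ch' : charged t l by apply: chargedW ch; lia.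
by apply/defect_eq0 => //; [exact: wp|exact: fb].
Qed.

Hypothesis u0_control : exists v, control v.

(** The costs differ only in a sum of nonnegative defects, and the feedback control makes this sum
    zero. *)
Lemma poptimalP : (forall t, (t <= N - d)%N -> W_pos_on t) -> forall v,
  poptimal v <-> control v /\
    forall t, (t <= N - d)%N -> forall l, charged t l -> feedback v t l.
Proof.
move=> wp v; split=> [[cv opt]|[cv fb]]; split=> //; last first.
  move=> v' cv'; rewrite !pcostE // -/(pbase v) -/(pbase v') (pbase_eq cv cv') lerD2l.
  apply: ler_sum => t _; have tN : (t <= N - d)%N by rewrite -ltnS.
  rewrite Ex_defect_eq0 //; [exact: Ex_defect_ge0 (wp _ tN)|exact: wp|exact: fb].
pose v1 := feedback_from v 0 (N - d).+1.
have c1 : control v1 by apply: feedback_from_control.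
have := opt v1 c1; rewrite !pcostE // -/(pbase v) -/(pbase v1) (pbase_eq cv c1) lerD2l.
rewrite [X in _ <= X]big1 => [le0 t tN l ch|t _]; last first.
  have tN : (t <= N - d)%N by rewrite -ltnS.
  by apply: Ex_defect_eq0 (wp _ tN) _ => // l _; apply: feedback_fromP.
(* [EP_eq0] speaks of paths charged up to the horizon, so l is prolonged; the defect at time t does
   not see the change. *)
have [l' ag ch'] : exists2 l', agree t l l' & charged N.+1 l'.
  by apply: charged_ext => //; lia.
have sq0 : Ex (fun l => (defect v t l) 0 0) = 0.
  apply/eqP; rewrite eq_le Ex_defect_ge0 ?andbT //; last exact: wp.
  have tN' : (t < (N - d).+1)%N by [].
  move: le0; rewrite (bigD1 (Ordinal tN')) //=; apply: le_trans.
  rewrite lerDl; apply: sumr_ge0 => i _.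
  by apply: Ex_defect_ge0; [|apply: wp]; rewrite -ltnS.
have [va _ _] := cv; have asq := @adapted_defect v t va.
apply/defect_eq0 => //; first exact: wp.
rewrite (asq _ _ ag).
apply: (@EP_eq0 _ _ (trans S) p0 N.+1 _ _ (fun l => (defect v t l) 0 0) l') => //.
  by move=> l1 l2 ag'; rewrite (asq l1 l2) //; apply: agreeW ag'; lia.
move=> l1 ch1; apply: defect_ge0 => //; apply: wp => //.
by apply: chargedW ch1; lia.
Qed.

Lemma feedback_unique v v' : control v -> control v' ->
  (forall t, (t <= N - d)%N -> forall l, charged t l -> feedback v t l) ->
  (forall t, (t <= N - d)%N -> forall l, charged t l -> feedback v' t l) ->
  forall k l, (k <= N)%N -> charged (k - d) l -> v k l = v' k l.
Proof.
move=> [_ _ vi] [_ _ vi'] fb fb' k l; have [c] := ubnP k.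
elim: c k => // c IH k kc kN ch; have [kd|dk] := ltnP k d; first by rewrite vi // vi'.
have h : (k - d <= N - d)%N by lia.
have := fb _ h l ch; have := fb' _ h l ch; rewrite /feedback subnK // => -> ->.
congr (- (_ *m _)); apply: gain_ext => [|j jk]; first by lia.
by apply: IH; try lia; apply: chargedW ch; lia.
Qed.

Lemma feedback_exists : exists2 v, control v & forall t, (t <= N - d)%N ->
  forall l, feedback v t l.
Proof.
have [v cv] := u0_control; exists (feedback_from v 0 (N - d).+1).
  exact: feedback_from_control.
by move=> t tN l; apply: feedback_fromP.
Qed.


(** The perturbation acts at the single mode i, so that its second-order effect involves W at that
    mode alone. *)
Definition bump v t (i : 'I_L) (z : 'cV[R]_m) (c : R) k l :=
  if (k == t + d)%N && (l t == i) then v k l + c *: z else v k l.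

Lemma bump_control v t (i : 'I_L) z c : (t <= N - d)%N -> control v -> control (bump v t i z c).
Proof.
move=> tN [va vl vi]; split=> [k|k l kN|k l kd]; rewrite /bump.
- have [->|_] := eqVneq k (t + d)%N => /=; last exact: va.
  by rewrite addnK => l l' ag; rewrite (va _ l l') ?addnK // ag.
- by rewrite ifF ?vl //; lia.
- by rewrite ifF ?vi //; lia.
Qed.

Lemma defect_bump v t (i : 'I_L) z c l : (defect (bump v t i z c) t l) 0 0 =
  (defect v t l) 0 0
  + c * (if l t == i then ((gain v (d - 1) t l)^T *m z + z^T *m gain v (d - 1) t l
           + z^T *m W_ t l *m v (t + d)%N l + (v (t + d)%N l)^T *m W_ t l *m z) 0 0
         else 0)
  + c ^+ 2 * (if l t == i then qform (W_ t l) z else 0).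
Proof.
have gE : gain (bump v t i z c) (d - 1) t l = gain v (d - 1) t l.
  by apply: gain_ext => [|k kt]; rewrite /bump ?ifF //; lia.
rewrite /defect gE /bump eqxx /=; case: eqP => _; last by rewrite !mulr0 !addr0.
move: (gain _ _ _ _) (v _ _) => g u; rewrite /qform.
transitivity ((g^T *m (Winv t l *m g + u) + u^T *m (g + W_ t l *m u)
  + c *: (g^T *m z + z^T *m g + z^T *m W_ t l *m u + u^T *m W_ t l *m z)
  + c ^+ 2 *: (z^T *m W_ t l *m z)) 0 0); last by rewrite !mxE.
congr (fun_of_matrix _ 0 0).
have -> : (u + c *: z)^T = u^T + c *: z^T by rewrite linearD /= linearZ.
rewrite !mulmxDl !mulmxDr -!scalemxAr -!scalemxAl -?scalemxAr !mulmxA !scalerDr.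
rewrite scalerA -expr2 !addrA.
by rewrite [LHS](AC 9 (1*2*4*5*3*7*8*6*9)).
Qed.

(* If W_t fails to be positive at some mode, a bump of u(t) along a bad direction,
   followed by the feedback law, gives a whole line of optimal controls. *)
Lemma W_pos_of_unique : (exists v, poptimal v) ->
  (forall v v', poptimal v -> poptimal v' ->
     forall k l, (k <= N)%N -> charged (k - d) l -> v k l = v' k l) ->
  forall t, (t <= N - d)%N -> W_pos_on t.
Proof.
move=> [v [cv vopt]] uniq t0 t0N.
(* Backwards in time: positivity after t is what makes the feedback law annihilate all the later
   defects. *)
suff strong t : forall r, (t <= r <= N - d)%N -> W_pos_on r by apply: (strong t0); lia.
move: t; apply: (@downward_ind (N - d).+1) => [t Nt r|t Nt IH r]; first by lia.
move=> /andP[]; rewrite leq_eqVlt => /orP[/eqP <- tN|tr rN]; last by apply: IH; lia.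
move=> {r} l0 ch0; have [|_ _ symW _] := @sym_all t _ l0; first by lia.
split=> [|z z0]; first exact: symW.
rewrite ltNge; apply/negP => le0; set i := l0 t.
(* Imposing the law at t + 1, ..., N - d leaves a cost that is exactly quadratic in c, with leading
   coefficient [q]. *)
pose w c := feedback_from (bump v t i z c) t.+1 (N - d - t).
have cb c : control (bump v t i z c) by exact: bump_control.
have cw c : control (w c) by apply: feedback_from_control => //; lia.
have wE c k l : (k < t.+1 + d)%N -> w c k l = bump v t i z c k l.
  by move=> kt; rewrite /w feedback_from_early.
pose b := Ex (fun l => if l t == i then
  ((gain v (d - 1) t l)^T *m z + z^T *m gain v (d - 1) t l
   + z^T *m W_ t l *m v (t + d)%N l + (v (t + d)%N l)^T *m W_ t l *m z) 0 0 else 0).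
pose q := Ex (fun l => if l t == i then qform (W_ t l) z else 0).
pose a := pbase v + \sum_(r < t) Ex (fun l => (defect v r l) 0 0)
  + Ex (fun l => (defect v t l) 0 0).
have split_sum (f : nat -> R) : \sum_(r < (N - d).+1) f r =
    \sum_(r < t) f r + f t + \sum_(t.+1 <= r < (N - d).+1) f r.
  rewrite -(big_mkord xpredT) (big_cat_nat (n := t.+1)) //=.
  by rewrite big_nat_recr //= big_mkord.
have costw c : pcost (w c) = a + c * b + c ^+ 2 * q.
  rewrite pcostE // -/(pbase _) (pbase_eq (cw c) cv).
  rewrite (split_sum (fun r => Ex (fun l => (defect (w c) r l) 0 0))).
  rewrite [X in _ + (_ + X)]big_nat [X in _ + (_ + X)]big1 ?addr0 => [|r rt]; last first.
    apply: Ex_defect_eq0 => [| |l _]; [by lia|by apply: IH; lia|].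
    by apply: feedback_fromP; lia.
  rewrite /a -!addrA; congr (_ + (_ + _)).
    apply: eq_bigr => r _; apply: eq_EP => l; congr (fun_of_matrix _ 0 0).
    apply: defect_ext => k kr; have rt := ltn_ord r.
    by rewrite wE /bump ?ifF //; lia.
  rewrite /b /q -!EPZ -!EPD; apply: eq_EP => l.
  rewrite addrA -defect_bump; congr (fun_of_matrix _ 0 0).
  by apply: defect_ext => k kt; rewrite wE //; lia.
have q_le0 : q <= 0.
  rewrite -oppr_ge0 -EPN; apply: EP_ge0 => // l _; case: eqP => [lt|_]; last by rewrite oppr0.
  by rewrite oppr_ge0 /W_ lt.
(* Compared with the cost of v, [a] omits the defects after time t, which are nonnegative by
   induction. *)
have a_le : a <= pcost v.
  rewrite pcostE // -/(pbase v) (split_sum (fun r => Ex (fun l => (defect v r l) 0 0))).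
  rewrite /a addrA addrA lerDl big_nat; apply: sumr_ge0 => r rt.
  by apply: Ex_defect_ge0; [lia|apply: IH; lia].
(* The bounds a <= a + b + q and a <= a - b + q add up to q >= 0; since q <= 0, both q and b
   vanish. *)
have opt1 := vopt _ (cw 1); have optN1 := vopt _ (cw (-1)).
rewrite !costw in opt1 optN1.
have [b0 q0] : b = 0 /\ q = 0 by split; lra.
have opt c : poptimal (w c).
  split=> // v' cv'; rewrite costw b0 q0 !mulr0 !addr0.
  exact: le_trans a_le (vopt _ cv').
have := uniq _ _ (opt 0) (opt 1) (t + d)%N l0.
rewrite addnK !wE; try lia.
rewrite /bump eqxx eqxx /= scale0r addr0 scale1r => /(_ _ ch0) h.
have /eqP := h ltac:(lia); rewrite -subr_eq0 opprD addrA subrr add0r oppr_eq0.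
by rewrite (negPf z0).
Qed.

(** * Costate and cost along the optimal trajectory *)

Lemma sum_triangle (V : nmodType) c (f : nat -> nat -> V) :
  \sum_(1 <= s < c) \sum_(1 <= r < s) f r s =
  \sum_(1 <= r < c) \sum_(r.+1 <= s < c) f r s.
Proof.
elim: c => [|[|c] IH]; [by rewrite !big_geq|by rewrite !big_geq|].
rewrite big_nat_recr //= IH [RHS]big_nat_recr //= [X in _ = _ + X]big_geq // addr0.
rewrite -big_split; apply: eq_big_nat => r rc.
by rewrite [RHS]big_nat_recr //; lia.
Qed.

Section OptimalTrajectory.
Variable v : nat -> (nat -> 'I_L) -> 'cV[R]_m.
Hypothesis cv : control v.
Hypothesis fb : forall t, (t <= N - d)%N -> forall l, charged t l -> feedback v t l.

(** After N - d both sides of the law are zero. *)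
Lemma feedback_all t l : charged t l -> feedback v t l.
Proof.
have [tN|tN] := leqP t (N - d); first exact: fb.
have [_ v_late _] := cv; rewrite /feedback v_late ?Winv_late ?mul0mx ?oppr0 //; lia.
Qed.

Lemma costate_step t l : (t < N)%N -> charged t l ->
  Lam t t.+1 (fun l => (A_ t.+1 l)^T *m costate_form v t.+1 l + Q_ t.+1 l *m xs v t.+1 l) l =
  costate_form v t l.
Proof.
move=> tN ch; have [va v_late _] := cv; rewrite Lam_costate_form //.
by have -> := feedback_all ch; rewrite subrr mulmx0 addr0.
Qed.

Lemma costate_last l :
  Lam N N.+1 (fun l => costP S (l N.+1) *m xs v N.+1 l) l = costate_form v N l.
Proof.
have [va v_late _] := cv.
rewrite (Lambda_mulr _ _ _ _ (@adapted_xs v va N)) -(cdre_P_last hX).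
rewrite /costate_form big1 ?addr0 => [|i _]; last by rewrite v_late ?mulmx0 //; lia.
rewrite /Pd P0E // (@T_late N l _).1; last by lia.
by rewrite mulmx0 subr0.
Qed.

(** alpha^{d-s} at the modes l_t and l_{t+1-s}, that is with k = t + 1, indexed by the lag s. *)
Definition alpha_ s t l := ric_alpha X (d - s) t (t.+1 - s) l.

Lemma alpha_rec s t l : (t < N)%N -> (1 <= s < d)%N -> (s <= t.+1)%N ->
  (alpha_ s t l)^T = (D_ (d - s) t l)^T
  - \sum_(1 <= r < s) (alpha_ r t l)^T *m Winv (t - r) l *m T_ (d - s + r) (t - r) l.
Proof.
move=> tN sd st; rewrite /alpha_ (_ : (D_ (d - s) t l = ric_delta X (d - s) t (l t))); last first.
  by rewrite (_ : (d - s = (d - s).-1.+1)%N) //; lia.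
have [s1|s1] := eqVneq s 1%N.
  rewrite s1 big_geq // subr0 subSS subn0.
  have := @aux_alpha1 _ _ _ _ _ _ _ _ hX' t.+1 l; rewrite subSS subn0.
  by apply; lia.
have := @aux_alpha _ _ _ _ _ _ _ _ hX' t.+1 s l; rewrite subSS subn0 => -> //; try lia.
congr (_ - _); apply: eq_big_nat => r rs.
by rewrite (_ : (t.+1 - r - 1 = t - r)%N) //; lia.
Qed.

Lemma adapted_alpha s t : (t < N)%N -> (1 <= s < d)%N -> (s <= t.+1)%N ->
  adapted t (alpha_ s t).
Proof.
move=> tN; have [c] := ubnP s; elim: c s => // c IH s sc sd st l l' ag.
apply: trmx_inj; rewrite !alpha_rec // (adapted_D _ ag); congr (_ - _).
apply: eq_big_nat => r rs; rewrite (IH r _ _ _ l l') //; try lia.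
by rewrite /Winv /T_ ag //; lia.
Qed.

(* The matrices [alpha_] are built so that projecting [alpha_ s t *m x(t+1)] on the
   past of time t-s gives the part of [gain] known from the inputs up to v(t). *)
Lemma Lambda_alpha s t l : (t < N)%N -> (1 <= s < d)%N -> (s <= t)%N ->
  (t - s <= N - d)%N ->
  Lam (t - s) t (fun l => alpha_ s t l *m xs v t.+1 l) l = gain v s (t - s) l.
Proof.
move=> tN; have [c] := ubnP s; elim: c s l => // c IH s l sc sd st tsN.
have [va v_late _] := cv; set t0 := (t - s)%N.
have t0s : (t0 + s = t)%N by rewrite subnK.
(* The gradient in v(t0+d) that keeps only the inputs up to v(t); at r = s just the term in x(t+1)
   remains. The truncated gain in [h r] has the smaller lag s - r, so the induction hypothesis
   applies to it. *)
pose f r := grad v (d - r) (s - r) (t0 + r).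
pose h r l := (T_ (d - r) (t0 + r) l)^T *m (Winv (t0 + r) l *m gain v (s - r) (t0 + r) l).
have -> : gain v s t0 l = Lam t0 t0.+1 (f 1) l.
  rewrite /f addn1 (Lam_grad_last_trunc va); try lia.
  by rewrite (_ : (s - 1).+1 = s)%N //; lia.
have -> := @unroll _ t0 s f h l; first last; [move=> r l' rs|by lia|].
  rewrite /f /h; have := @Lam_grad_trunc v va (d - r.+1) (s - r.+1) (t0 + r) l'.
  rewrite !subnSK ?addnS; try lia.
  by move=> ->; try lia; rewrite addrK.
rewrite t0s {1}/f t0s subnn sum_rev1.
transitivity (Lam t0 t (fun l => grad v (d - s) 0 t l
  - \sum_(1 <= r < s) (T_ (d - s + r) (t - r) l)^T *m Winv (t - r) l
      *m (alpha_ r t l *m xs v t.+1 l)) l).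
  apply: eq_Lambda => l'; have -> : grad v (d - s) 0 t l' = D_ (d - s) t l' *m xs v t.+1 l'.
    rewrite (_ : (d - s = (d - s).-1.+1)%N); last by lia.
    by rewrite /grad big_ord0 !addr0.
  rewrite -[alpha_ s t l']trmxK alpha_rec ?raddfB /= ?trmxK ?mulmxBl; try lia.
  congr (_ - _); rewrite raddf_sum /= mulmx_suml; apply: eq_big_nat => r rs.
  have [_ hW _ _] := @sym_all (t - r) (leq_trans (leq_subr _ _) (ltnW tN)) l'.
  by rewrite !trmx_mul trmxK hW !mulmxA.
rewrite LambdaB Lambda_sum; congr (_ - _); apply: eq_big_nat => r rs.
rewrite /h (_ : (t0 + (s - r) = t - r)%N); last by lia.
rewrite (_ : (d - (s - r) = d - s + r)%N); last by lia.
rewrite (_ : (s - (s - r) = r)%N); last by lia.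
rewrite (@Lambda_trans _ _ _ _ t0 (t - r)); last by lia.
apply: eq_Lambda => l'.
rewrite (@Lambda_mull _ _ _ _ _ _ _ _ (fun l => (T_ (d - s + r) (t - r) l)^T *m Winv (t - r) l)).
  have [trN|trN] := leqP (t - r) (N - d); last by rewrite Winv_late // mul0mx !mulmx0 mul0mx.
  by rewrite IH ?mulmxA //; lia.
by move=> l1 l2 ag; rewrite (adapted_T _ ag) (adapted_Winv ag).
Qed.

(** Separates the inputs up to v(t), which the state x(t+1) already contains, from the later ones.
    The bound d <= t + 1 keeps the subtractions t - r from being truncated. *)
Lemma gain_split s t l : (d <= t.+1)%N -> (1 <= s < d)%N ->
  gain v (d - 1) (t - s) l = gain v s (t - s) l
  + \sum_(s.+1 <= r < d) T_ (d + s - r) (t - s) l *m v (t - r + d) l.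
Proof.
move=> dt sd; rewrite /gain -addrA; congr (_ + _).
rewrite -!(big_mkord xpredT (fun i => T_ i.+1 (t - s) l *m v (t - s + i.+1) l)).
rewrite (big_cat_nat (n := s)) //=; last by lia.
congr (_ + _); rewrite -{1}[s]add0n big_addn.
rewrite [RHS]big_nat_rev -[in RHS](add0n s.+1) big_addn.
rewrite (_ : (d - 1 - s = d - s.+1)%N); last by lia.
apply: eq_big_nat => i id.
by congr (T_ _ _ _ *m v _ _); lia.
Qed.

(** Back substitution: [alpha_rec] expresses each coefficient [D_] by the alphas, and after
    exchanging the two sums the terms in T cancel against the later inputs in the feedback law,
    leaving the truncated gains. *)
Lemma costate_form_alpha t l : (d <= t.+1)%N -> (t < N)%N -> charged t l ->
  costate_form v t l = Pd t l *m xs v t.+1 l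
  - \sum_(1 <= s < d) (alpha_ s t l)^T *m Winv (t - s) l *m gain v s (t - s) l.
Proof.
move=> dt tN ch; rewrite /costate_form; congr (_ + _).
transitivity (\sum_(1 <= s < d) (D_ (d - s) t l)^T *m v (t - s + d) l).
  rewrite sum_rev1 big_add1 -(big_mkord xpredT (fun i => (D_ i.+1 t l)^T *m v (t + i.+1) l)).
  by apply: eq_big_nat => i id; congr ((D_ _ _ _)^T *m v _ _); lia.
rewrite -sumrN.
transitivity (\sum_(1 <= s < d) ((alpha_ s t l)^T *m v (t - s + d) l
  + \sum_(1 <= r < s) (alpha_ r t l)^T *m Winv (t - r) l *m T_ (d - s + r) (t - r) l
      *m v (t - s + d) l)).
  apply: eq_big_nat => s sd; rewrite -mulmx_suml -mulmxDl; congr (_ *m _).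
  by rewrite alpha_rec ?subrK //; lia.
rewrite big_split /= sum_triangle -big_split; apply: eq_big_nat => s sd /=.
have -> := @feedback_all (t - s) l (chargedW (leq_subr _ _) ch).
rewrite gain_split //; move: (gain v s _ l) => y.
have -> : \sum_(s.+1 <= r < d) (alpha_ s t l)^T *m Winv (t - s) l
      *m T_ (d - r + s) (t - s) l *m v (t - r + d) l =
    (alpha_ s t l)^T *m Winv (t - s) l
      *m \sum_(s.+1 <= r < d) T_ (d + s - r) (t - s) l *m v (t - r + d) l.
  rewrite mulmx_sumr; apply: eq_big_nat => r rs; rewrite mulmxA.
  by rewrite (_ : (d - r + s = d + s - r)%N) //; lia.
move: (\sum_(_ <= _ < _) _) => z.
by rewrite mulmxN mulmxA mulmxDr opprD subrK.
Qed.

Lemma adapted_grad j c t : (c < d)%N -> adapted t (grad v j c t).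
Proof.
have [va _ _] := cv; move=> cd l l' ag; rewrite /grad (adapted_xs va ag) (adapted_D _ ag).
congr (_ + _ + _).
  apply: eq_bigr => i _; rewrite (adapted_M _ _ ag) (adapted_v va _ ag) //.
  by have := ltn_ord i; lia.
case: j => [|//]; rewrite (adapted_R ag) (va t l l') //.
by apply: agreeW ag; lia.
Qed.

Lemma pcost_value_form t : (t <= N)%N -> (forall t, (t <= N - d)%N -> W_pos_on t) ->
  pcost v = Ex (fun l => (value_form v t l) 0 0)
    + \sum_(0 <= k < t.+1) Ex (fun l => (running v k l) 0 0).
Proof.
move=> + wp; elim: t => [_|t IH tN].
  rewrite pcostE // big1 => [|t _]; last first.
    have tN : (t <= N - d)%N by rewrite -ltnS.
    by apply: Ex_defect_eq0 (wp _ tN) (fb tN).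
  rewrite addr0 big_nat1 -EPD; apply: eq_EP => l; exact: mxE.
rewrite IH ?(ltnW tN) // [in RHS]big_nat_recr //= addrCA addrC; congr (_ + _).
rewrite [RHS]Ex_value_form_step //; case: ifP => tNd; last by rewrite addr0.
by rewrite Ex_defect_eq0 ?addr0 //; [exact: wp|exact: fb].
Qed.

(** The gradient in v(s+d), seen at the later time s + c + 1, projects to zero at the decision time
    s: by the law at s itself, and in between because the residuals of [Lam_grad] vanish. *)
Lemma Lam_grad_zero c s l : (forall t, (t <= N - d)%N -> W_pos_on t) ->
  (c < d)%N -> (s + c < N)%N -> (s <= N - d)%N -> charged s l ->
  Lam s (s + c).+1 (grad v (d - c.+1) (d - 1) (s + c).+1) l = 0.
Proof.
move=> wp + + sN ch; have [va v_late _] := cv.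
elim: c => [_ _|c IH cd scN].
  rewrite addn0 Lam_grad_last //; have -> := fb sN ch.
  have uW := posdef_unit (wp _ sN _ ch).
  by rewrite /Winv /W_inv sN mulmxN mulmxA mulmxV // mul1mx subrr.
rewrite addnS (@Lambda_trans _ _ _ _ s (s + c).+1); last by lia.
rewrite -[RHS]IH; try lia; apply: Lambda_eq_reach => l' rch.
rewrite (_ : (d - c.+1 = (d - c.+2).+1)%N); last by lia.
rewrite Lam_grad //; try lia.
have ch' := reach_charged ch rch.
by have -> := feedback_all ch'; rewrite subrr mulmx0 addr0.
Qed.

(** The input v(d+i) is known at time i, where the gradient paired with it projects to zero; only
    the pairing of state and costate survives. *)
Lemma value_form_costate_form : (forall t, (t <= N - d)%N -> W_pos_on t) ->
  Ex (fun l => (value_form v (d - 1) l) 0 0) =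
  Ex (fun l => ((xs v d l)^T *m costate_form v (d - 1) l) 0 0).
Proof.
move=> wp; have [va v_late _] := cv; have dE : ((d - 1).+1 = d)%N by lia.
transitivity (Ex (fun l => ((xs v d l)^T *m costate_form v (d - 1) l) 0 0
  + \sum_(i < d.-1) ((v (d - 1 + i.+1) l)^T *m grad v i.+1 (d - 1) (d - 1) l) 0 0)).
  by apply: eq_EP => l; rewrite /value_form dE [LHS]mxE summxE.
rewrite EPD EP_sum [X in _ + X]big1 ?addr0 // => i _.
have id := ltn_ord i.
have [iN|iN] := leqP i (N - d); last first.
  rewrite -[RHS](EP0 (trans S) p0 N.+1); apply: eq_EP => l.
  by rewrite v_late ?trmx0 ?mul0mx ?mxE //; lia.
have vi : adapted i (v (d - 1 + i.+1)) by apply: (adaptedW _ (@va _)); lia.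
rewrite -(@Ex_scalar i (d - 1)); last 2 first.
- by lia.
- have vi' := adaptedW (_ : (i <= d - 1)%N) vi.
  move=> l l' ag; rewrite (vi' _ l l' ag) ?(@adapted_grad _ _ _ _ l l' ag) //; lia.
rewrite -[RHS](EP0 (trans S) p0 N.+1); apply: EP_eq => l ch.
rewrite (@Lambda_mull _ _ _ _ _ _ _ _ (fun l => (v (d - 1 + i.+1) l)^T)); last exact: adapted1.
have := @Lam_grad_zero (d - 1 - i.+1) i l wp.
rewrite (_ : (i + (d - 1 - i.+1)).+1 = (d - 1))%N; last by lia.
rewrite (_ : (d - (d - 1 - i.+1).+1) = i.+1)%N; last by lia.
move=> ->; rewrite ?mulmx0 ?mxE //; try lia.
by apply: chargedW ch; lia.
Qed.

End OptimalTrajectory.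
End OneStep.

(** * Law of the mode path *)

Section Coordinates.
Context {disp : measure_display} {O : measurableType disp} {R : realType} {L : nat}.
Variable th : nat -> O -> 'I_L.
Implicit Types (l : nat -> 'I_L) (s t : nat).

Definition mode_path w : nat -> 'I_L := fun t => th t w.

(** Counts coordinates instead of naming the last one, so that induction on c starts from constant
    functions. *)
Definition depends (V : Type) c (f : (nat -> 'I_L) -> V) :=
  forall l l', (forall i, (i < c)%N -> l i = l' i) -> f l = f l'.

Lemma depends_set_mode (V : Type) c (f : (nat -> 'I_L) -> V) i :
  depends c.+1 f -> depends c (fun l => f (set_mode l c i)).
Proof.
move=> fc l l' h; apply: fc => k kc; rewrite /set_mode; case: eqP => // /eqP kc'.
by apply: h; lia.
Qed.

(** Expanding over the last coordinate gives a finite sum of indicators times functions of one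
    coordinate less. The space is arbitrary so that the sigma-algebra of the past may be used
    too. *)
Lemma measurable_path c (f : (nat -> 'I_L) -> R) :
  (forall t i, (t < c)%N -> measurable (th t @^-1` [set i])) ->
  depends c f -> measurable_fun setT (fun w => f (mode_path w)).
Proof.
elim: c f => [|c IH] f mth fc.
  (* [th 0 point] provides a mode, since L is not known to be positive. *)
  rewrite (_ : (fun w => _) = cst (f (fun=> th 0 point))); last first.
    by apply/funext => w; apply: fc.
  exact: measurable_cst.
rewrite (_ : (fun w => _) = fun w => \sum_i
    \1_(th c @^-1` [set i]) w * f (set_mode (mode_path w) c i)).
  apply: measurable_sum => i; apply: measurable_funM.
    by apply: measurable_indic; apply: mth.
  apply: (IH (fun l => f (set_mode l c i))) => [t j tc|]; first by apply: mth; lia.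
  exact: depends_set_mode.
apply/funext => w; rewrite (bigD1 (th c w)) //= indicE mem_set // mul1r.
rewrite (set_mode_id (mode_path w) c) big1 ?addr0 // => i neq.
by rewrite indicE memNset ?mul0r //= => /esym/eqP; rewrite (negPf neq).
Qed.

Lemma bounded_path c (f : (nat -> 'I_L) -> R) : depends c f ->
  exists M, forall w, `|f (mode_path w)| <= M.
Proof.
elim: c f => [|c IH] f fc.
  exists `|f (fun=> th 0 point)| => w.
  by rewrite (fc _ (fun=> th 0 point)).
have [M hM] := choice (fun i => IH _ (@depends_set_mode _ _ _ i fc)).
exists (\sum_i `|M i|) => w; rewrite (bigD1 (th c w)) //=.
rewrite -(set_mode_id (mode_path w) c) -[_ (set_mode _ _ _)]addr0.
apply: le_trans (ler_normD _ _) _; apply: lerD; last by rewrite normr0 sumr_ge0.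
exact: le_trans (hM _ _) (ler_norm _).
Qed.

Lemma adapted_depends (V : Type) t (f : (nat -> 'I_L) -> V) :
  adapted t f -> depends t.+1 f.
Proof. by move=> ft l l' h; apply: ft => i it; apply: h. Qed.

End Coordinates.

(** * Cylinder sets, conditional expectations and the sigma-algebra of the past *)

Section ChainLaw.
Context {disp : measure_display} {Omega : measurableType disp} {R : realType}.
Variable P : probability Omega R.
Context {L : nat}.
Variables (lam : 'I_L -> 'I_L -> R) (theta : nat -> Omega -> 'I_L).
Hypothesis chain : markov_chain P lam theta.
Implicit Types (l : nat -> 'I_L) (s t : nat).

Local Notation mpath := (mode_path theta).

Definition initial_law i : R := fine (P (theta 0 @^-1` [set i])).

Local Notation charged := (charged lam initial_law).

Lemma measurable_mode t i : measurable (theta t @^-1` [set i]).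
Proof. by have [mt _ _ _] := chain; exact: mt. Qed.

Lemma lam_ge0 i j : 0 <= lam i j.
Proof. by have [_ h _ _] := chain. Qed.

Lemma lam_sum1 i : \sum_j lam i j = 1.
Proof. by have [_ _ h _] := chain. Qed.

Lemma initial_law_ge0 i : 0 <= initial_law i.
Proof. exact: fine_ge0. Qed.

Definition cyl s l : set Omega := [set w | forall i, (i <= s)%N -> theta i w = l i].

Lemma cylS s l : cyl s.+1 l = cyl s l `&` (theta s.+1 @^-1` [set l s.+1]).
Proof.
apply/seteqP; split=> w /= h; first by split=> [i is_|]; apply: h => //; exact: leqW.
by move=> i; rewrite leq_eqVlt => /orP[/eqP ->|/h.1 //]; exact: h.2.
Qed.

Lemma cyl0 l : cyl 0 l = theta 0 @^-1` [set l 0].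
Proof.
apply/seteqP; split=> w /= h; first exact: h.
by move=> i; rewrite leqn0 => /eqP ->.
Qed.

Lemma measurable_cyl s l : measurable (cyl s l).
Proof.
elim: s => [|s IH]; first by rewrite cyl0; exact: measurable_mode.
by rewrite cylS; apply: measurableI => //; exact: measurable_mode.
Qed.

Fixpoint weight s l : R :=
  if s is s'.+1 then weight s' l * lam (l s') (l s) else initial_law (l 0).

Lemma weight_agree s l l' : agree s l l' -> weight s l = weight s l'.
Proof.
elim: s => [|s IH] ag /=; first by rewrite ag.
by rewrite IH ?ag //; exact: agreeW ag.
Qed.

Lemma P_cyl s l : P (cyl s l) = (weight s l)%:E.
Proof.
elim: s => [|s IH]; first by rewrite cyl0 /= fineK // fin_num_measure //; exact: measurable_mode.
have [_ _ _ step] := chain.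
by have := step s l; rewrite -/(cyl s.+1 l) -/(cyl s l) IH.
Qed.

Lemma weight_charged s l : (weight s l != 0) = `[< charged s l >].
Proof.
apply/idP/asboolP.
  elim: s => [|s IH] /=; first by split.
  rewrite mulf_eq0 negb_or => /andP[/IH[h0 h1] nz]; split=> // k.
  by rewrite ltnS leq_eqVlt => /orP[/eqP ->|/h1].
elim: s => [|s IH] [h0 h1] //=; rewrite mulf_neq0 ?h1 // IH //.
by split=> // k ks; apply: h1; exact: ltnW.
Qed.

Lemma adapted_measurable t (f : (nat -> 'I_L) -> R) : adapted t f ->
  measurable_fun setT (fun w => f (mpath w)).
Proof.
move=> ft; apply: (@measurable_path _ _ _ _ theta t.+1) => [s i _|].
  exact: measurable_mode.
exact: adapted_depends.
Qed.

Lemma adapted_integrable t (f : (nat -> 'I_L) -> R) : adapted t f ->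
  P.-integrable setT (EFin \o (fun w => f (mpath w))).
Proof.
move=> ft; apply: measurable_bounded_integrable => //.
  exact: fin_num_fun_lty.
  exact: adapted_measurable ft.
have [M hM] := @bounded_path _ _ _ _ theta _ _ (adapted_depends ft).
exists M; split; first exact: num_real.
by move=> x Mx w _ /=; apply: le_trans (hM w) (ltW Mx).
Qed.

(** Splitting a cylinder according to the next mode mirrors one summation of [Lambda]; this
    identifies iterated sums with conditional expectations. *)
Lemma integral_cyl s T l (f : (nat -> 'I_L) -> R) : (s <= T)%N -> adapted T f ->
  (\int[P]_(w in cyl s l) (f (mpath w))%:E =
   (weight s l * Lambda lam s T (f : _ -> R^o) l)%:E)%E.
Proof.
move=> sT fT; move: s l sT; apply: (@downward_ind T) => [s Ts l sT|s sT IH l _].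
  have <- : T = s by lia.
  rewrite Lambda_ge //.
  transitivity (\int[P]_(w in cyl T l) (f l)%:E)%E.
    by apply: eq_integral => w; rewrite inE => ag; rewrite (fT _ l).
  rewrite integral_cst; last exact: measurable_cyl.
  by rewrite [X in (_ * X)%E]P_cyl -EFinM mulrC.
have -> : cyl s l = \big[setU/set0]_(i <- enum 'I_L) cyl s.+1 (set_mode l s.+1 i).
  rewrite -bigcup_seq; apply/seteqP; split=> w.
    move=> h; exists (theta s.+1 w); first by rewrite /= mem_enum.
    move=> i; rewrite leq_eqVlt => /orP[/eqP ->|is_]; first by rewrite set_mode_eq.
    by rewrite -(agree_set_mode l _ (ltnSn s)) // h.
  case=> i _ h k ks; rewrite h; last exact: leqW.
  by rewrite -(agree_set_mode l _ (ltnSn s)).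
rewrite integral_bigsetU_EFin.
- rewrite big_enum /= LambdaS // mulr_sumr -sumEFin; apply: eq_bigr => i _.
  rewrite IH // /= set_mode_eq -(weight_agree (agree_set_mode l i (ltnSn s))).
  by rewrite -(agree_set_mode l i (ltnSn s)) // -mulrA.
- by move=> i; exact: measurable_cyl.
- exact: enum_uniq.
- move=> i j _ _ [w [/= hi hj]].
  by rewrite -(set_mode_eq l s.+1 i) -hi // hj // set_mode_eq.
- by apply/measurable_EFinP; apply: measurable_funTS; exact: adapted_measurable fT.
Qed.

Lemma expectation_path T (f : (nat -> 'I_L) -> R) : adapted T f ->
  (\int[P]_w (f (mpath w))%:E = (EP lam initial_law T f)%:E)%E.
Proof.
move=> fT.
have -> : [set: Omega] = \big[setU/set0]_(i <- enum 'I_L) cyl 0 (fun=> i).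
  rewrite -bigcup_seq; apply/seteqP; split=> w // _.
  exists (theta 0 w); first by rewrite /= mem_enum.
  by move=> i; rewrite leqn0 => /eqP ->.
rewrite integral_bigsetU_EFin.
- rewrite big_enum /= -sumEFin; apply: eq_bigr => i _.
  exact: integral_cyl.
- by move=> i; exact: measurable_cyl.
- exact: enum_uniq.
- by move=> i j _ _ [w [/= hi hj]]; rewrite -(hi 0) // hj.
- by apply/measurable_EFinP; apply: measurable_funTS; exact: adapted_measurable fT.
Qed.

Lemma ae_charged T : {ae P, forall w, charged T (mpath w)}.
Proof.
pose f l : R := (~~ `[< charged T l >])%:R.
have fT : adapted T f.
  move=> l l' ag; rewrite /f; congr (_ (~~ _))%:R; apply: asbool_equiv_eq.
  by split; apply: charged_agree => //; exact: agree_sym.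
have mf := adapted_measurable fT.
exists ((fun w => f (mpath w)) @^-1` [set 1]); split.
- by rewrite -[X in measurable X]setTI; exact: mf.
- have : (\int[P]_w (f (mpath w))%:E = 0)%E.
    rewrite (expectation_path fT) (_ : EP _ _ _ _ = 0) //.
    rewrite -[RHS](EP0 lam initial_law T); apply: EP_eq => l ch.
    by rewrite /f asboolT.
  rewrite (_ : (fun w => _) = fun w =>
     (\1_((fun w => f (mpath w)) @^-1` [set 1]) w)%:E).
    rewrite integral_indic //; first by rewrite setIT.
    by rewrite -[X in measurable X]setTI; exact: mf.
  apply/funext => w; congr (_%:E); rewrite indicE /f.
  case: (boolP `[< _ >]) => h; last by rewrite mem_set //= h.
  by rewrite memNset //= h => /esym/eqP; rewrite oner_eq0.
by move=> w /= nch; rewrite /f asboolF.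
Qed.

(** The cylinder of a charged path has positive probability, so an almost sure property cannot fail
    on it. *)
Lemma charged_ae T (Q : (nat -> 'I_L) -> Prop) :
  adapted T Q -> {ae P, forall w, Q (mpath w)} -> forall l, charged T l -> Q l.
Proof.
move=> QT [A [mA A0 sA]] l ch; apply: contrapT => nQ.
have : P (cyl T l) = 0%E.
  apply/eqP; rewrite -measure_le0 -A0; apply: le_measure; rewrite ?inE //.
    exact: measurable_cyl.
  by move=> w /= ag; apply: sA => /=; rewrite (QT _ l).
rewrite P_cyl => -[/eqP]; apply/negP.
by rewrite weight_charged; apply/asboolP.
Qed.

Lemma past_measurableE s (f : (nat -> 'I_L) -> R) : adapted s f ->
  measurable_fun setT
    ((fun w => f (mpath w)) : g_sigma_algebraType (past theta s) -> R).
Proof.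
move=> fs; apply: (@measurable_path _ (g_sigma_algebraType (past theta s)) _ _ theta s.+1).
  by move=> t i ts; apply: sub_sigma_algebra; exists t, i.
exact: adapted_depends.
Qed.

(** Sets that do not distinguish outcomes with the same modes up to s form a sigma-algebra
    containing the generators. *)
Lemma past_invariant s (E : set Omega) : <<s past theta s >> E ->
  forall w w', agree s (mpath w) (mpath w') -> E w -> E w'.
Proof.
pose inv : set (set Omega) := [set E | forall w w',
  agree s (mpath w) (mpath w') -> E w <-> E w'].
suff sub : <<s past theta s >> `<=` inv by move=> hE w w' ag; have [] := sub _ hE w w' ag.
apply: smallest_sub; first split.
- by move=> w w' _; split.
- by move=> A hA w w' ag; split=> -[_ nA]; split=> // hw; apply: nA; apply/(hA _ _ ag).
- move=> F hF w w' ag; split=> -[k _ Fk]; exists k => //; exact/(hF k _ _ ag).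
- move=> _ [t [i [ts ->]]] w w' ag /=.
  by have /= := ag t ts; rewrite /mpath => ->.
Qed.

(** The factorization of a past-measurable variable through the modes it depends on. *)
Lemma measurable_past_path s (Y : Omega -> R) :
  measurable_fun setT (Y : g_sigma_algebraType (past theta s) -> R) ->
  exists2 y : (nat -> 'I_L) -> R, adapted s y & forall w, Y w = y (mpath w).
Proof.
move=> mY; have Yinv w w' : agree s (mpath w) (mpath w') -> Y w = Y w'.
  move=> ag; have mE : <<s past theta s >> (Y @^-1` [set Y w]).
    by have := mY measurableT [set Y w] (measurable_set1 _); rewrite setTI.
  by have /= := past_invariant mE ag => /(_ erefl).
have sol l : exists r, forall w, agree s (mpath w) l -> Y w = r.
  have [[w0 ag0]|no] := pselect (exists w, agree s (mpath w) l).
    exists (Y w0) => w ag; apply: Yinv.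
    exact: agree_trans ag (agree_sym ag0).
  by exists 0 => w ag; case: no; exists w.
have [y hy] := choice sol.
(* On prefixes realized by no outcome [y] is an arbitrary choice; the value 0 there makes the
   function adapted. *)
pose y' l := if `[< exists w, agree s (mpath w) l >] then y l else 0.
exists y' => [l l' ag|w]; last first.
  by rewrite /y' asboolT; [exact: hy|exists w].
have ex_iff : (exists w, agree s (mpath w) l) <-> (exists w, agree s (mpath w) l').
  split=> -[w h]; exists w; first exact: agree_trans h ag.
  exact: agree_trans h (agree_sym ag).
rewrite /y' (asbool_equiv_eq ex_iff); case: asboolP => // -[w h].
by rewrite -(hy l' w h) -(hy l w) //; apply: agree_trans h (agree_sym ag).
Qed.

Lemma is_cond_exp_path s T (f : (nat -> 'I_L) -> R) : (s <= T)%N -> adapted T f ->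
  is_cond_exp P (past theta s) (fun w => f (mpath w))
    (fun w => Lambda lam s T (f : _ -> R^o) (mpath w)).
Proof.
move=> sT fT; have aL := Lambda_adapted lam sT fT.
split; [exact: past_measurableE|exact: adapted_integrable aL|move=> E mE].
(* The indicator of E as an adapted function of the path, which turns integrals over E into [EP]. *)
pose e l : R := (`[< exists2 w, agree s (mpath w) l & E w >])%:R.
have es : adapted s e.
  move=> l l' ag; rewrite /e; congr (_%:R); congr nat_of_bool; apply: asbool_equiv_eq.
  split=> -[w h Ew]; exists w => //; first exact: agree_trans h ag.
  exact: agree_trans h (agree_sym ag).
have mE' : measurable E.
  move: E mE {e es}; apply: smallest_sub; first exact: sigma_algebra_measurable.
  by move=> _ [t [i [_ ->]]]; exact: measurable_mode.
have intE g : adapted T g ->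
    (\int[P]_(w in E) (g (mpath w))%:E = (EP lam initial_law T (fun l => (e l * g l)%R))%:E)%E.
  move=> gT; rewrite -expectation_path; last first.
    by move=> l l' ag; rewrite (gT l l' ag) (es l l') //; exact: agreeW ag.
  rewrite [LHS]integral_mkcond; apply: eq_integral => w _.
  rewrite patchE /e; case: ifPn; rewrite ?inE ?notin_setE => Ew.
    by rewrite asboolT ?mul1r //; exists w.
  rewrite asboolF ?mul0r // => -[w' ag Ew']; apply: Ew.
  exact: past_invariant ag Ew'.
rewrite !intE //; last exact: adaptedW aL.
congr (_%:E); rewrite -[RHS](@EP_Lambda _ _ lam _ _ lam_sum1 s T) //; last 2 first.
- by rewrite sT leqnn.
- by move=> l l' ag; rewrite (fT l l' ag) (es l l') //; exact: agreeW ag.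
apply: eq_EP => l; rewrite -[RHS](@Lambda_linear _ _ _ _ _ idfun).
transitivity (Lambda lam s T (fun l' => e l *: (f l' : R^o)) l).
  by rewrite (Lambda_linear lam ( *:%R (e l) : {linear R^o -> R^o}) s T f).
by apply: Lambda_eq => l' ag; rewrite (es l l').
Qed.

(** [cond_exp] is an arbitrarily chosen version, so it can be compared with [Lambda] on charged
    paths only, by integrating over their cylinders. *)
Lemma cond_exp_path s T (f : (nat -> 'I_L) -> R) : (s <= T)%N -> adapted T f ->
  exists y, [/\ adapted s y,
    forall w, cond_exp P (past theta s) (fun w => f (mpath w)) w = y (mpath w) &
    forall l, charged s l -> y l = Lambda lam s T (f : _ -> R^o) l].
Proof.
move=> sT fT; have aL := Lambda_adapted lam sT fT.
have := is_cond_exp_path sT fT => ex.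
have : is_cond_exp P (past theta s) (fun w => f (mpath w))
    (cond_exp P (past theta s) (fun w => f (mpath w))).
  by rewrite /cond_exp; case: xgetP => [? _ //|/(_ _ ex)].
move: (cond_exp _ _ _) => Y [mY iY hY].
have [y ys Yy] := measurable_past_path mY; exists y; split=> // l ch.
have mC : <<s past theta s >> (cyl s l).
  rewrite (_ : cyl s l = \bigcap_(i in `I_s.+1) (theta i @^-1` [set l i])); last first.
    by apply/seteqP; split=> w h i /=; rewrite ?ltnS => hi; apply: h; rewrite /= ?ltnS.
  apply: (@bigcap_measurableType _ (g_sigma_algebraType (past theta s))).
  by move=> i /=; rewrite ltnS => hi; apply: sub_sigma_algebra; exists i, (l i).
have [_ _ hL] := ex.
have := hY _ mC; rewrite -(hL _ mC).
rewrite (_ : (fun w => (Y w)%:E) = (fun w => (y (mpath w))%:E)); last first.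
  by apply/funext => w; rewrite Yy.
rewrite (integral_cyl l (leqnn s) ys) (integral_cyl l (leqnn s) aL).
rewrite !(@Lambda_ge _ _ _ _ s s _ _ (leqnn s)).
by move=> -[] h; apply: mulfI h; rewrite weight_charged; apply/asboolP.
Qed.

Lemma cond_exp_vec_path n s T (f : (nat -> 'I_L) -> 'cV[R]_n) : (s <= T)%N ->
  adapted T f ->
  exists y, [/\ adapted s y,
    forall w, cond_exp_vec P (past theta s) (fun w => f (mpath w)) w = y (mpath w) &
    forall l, charged s l -> y l = Lambda lam s T f l].
Proof.
move=> sT fT.
have h i := @cond_exp_path s T (fun l => f l i 0) sT (adapted1 (fun M : 'cV[R]_n => M i 0) fT).
have [y hy] := choice h.
exists (fun l => \col_i y i l); split=> [l l' ag|w|l ch].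
- by apply/colP => i; rewrite !mxE; have [ys _ _] := hy i; exact: ys.
- by apply/colP => i; rewrite !mxE; have [_ hw _] := hy i; exact: hw.
- apply/colP => i; rewrite !mxE Lambda_entry; have [_ _ hl] := hy i; exact: hl.
Qed.

Lemma past_measurable_path k n (X : Omega -> 'cV[R]_n) : past_measurable theta k X ->
  exists2 y : (nat -> 'I_L) -> 'cV[R]_n, adapted k y & forall w, X w = y (mpath w).
Proof.
move=> mX; have h i := measurable_past_path (mX i).
have [y hy] := choice (fun i => let: ex_intro2 y ys Yy := h i in ex_intro _ y (conj ys Yy)).
exists (fun l => \col_i y i l) => [l l' ag|w].
  by apply/colP => i; rewrite !mxE; exact: (hy i).1.
by apply/colP => i; rewrite mxE; exact: (hy i).2.
Qed.

Lemma path_past_measurable k n (y : (nat -> 'I_L) -> 'cV[R]_n) : adapted k y ->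
  past_measurable theta k (fun w => y (mpath w)).
Proof.
move=> yk i; apply: (@past_measurableE k (fun l => y l i 0)).
by move=> l l' ag; rewrite (yk l l').
Qed.

End ChainLaw.

(** * From mode paths to random variables *)

Section Bridge.
Context {R : realType} {disp : measure_display} {Omega : measurableType disp}.
Variables (P : probability Omega R) (L n m d N : nat).
Variables (theta : nat -> Omega -> 'I_L) (S : mjls R L n m) (X : riccati R L n m).
Hypotheses (hd : (0 < d)%N) (hN : (d < N)%N).
Hypothesis htheta : markov_chain P (trans S) theta.
Hypothesis hQ : forall k l, (k <= N)%N -> possemidef_mx (costQ S k l).
Hypothesis hR : forall k l, (d <= k <= N)%N -> possemidef_mx (costR S k l).
Hypothesis hP : forall l, symmetric_mx (costP S l).
Hypotheses (hX : solves_cdre S d N X) (hX' : solves_auxiliary S d N X).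
Implicit Types (u : nat -> Omega -> 'cV[R]_m) (v : nat -> (nat -> 'I_L) -> 'cV[R]_m).

Local Notation mpath := (mode_path theta).
Local Notation p0 := (initial_law P theta).
Local Notation charged := (charged (trans S) p0).

Definition initial_input (k : nat) : 'cV[R]_m := u_init S (k%:Z - d%:Z).

Local Notation control := (control d N initial_input).
Local Notation poptimal := (poptimal S d N p0 initial_input).

Definition realizes u v :=
  forall k w, (k <= N)%N -> input S u (k%:Z - d%:Z) w = v k (mpath w).

Lemma input_early u k w : (k < d)%N -> input S u (k%:Z - d%:Z) w = initial_input k.
Proof.
rewrite /initial_input => kd; have : (k%:Z - d%:Z < 0)%R by lia.
by case: (k%:Z - d%:Z)%R.
Qed.

Lemma input_late u k w : (d <= k)%N -> input S u (k%:Z - d%:Z) w = u (k - d)%N w.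
Proof. by move=> dk; rewrite subzn. Qed.

Lemma eq_cond_exp_vec p G (Y Y' : Omega -> 'cV[R]_p) w : Y =1 Y' ->
  cond_exp_vec P G Y w = cond_exp_vec P G Y' w.
Proof. by move=> /funext ->. Qed.

Lemma control_realizes v : control v ->
  exists2 u, admissible d N theta u & realizes u v.
Proof.
move=> [va v_late vi]; exists (fun k w => v (k + d)%N (mpath w)) => [k kN|k w kN].
  by apply: path_past_measurable; have := va (k + d)%N; rewrite addnK.
have [kd|dk] := ltnP k d; first by rewrite input_early // vi.
by rewrite input_late // subnK.
Qed.

Lemma admissible_realizes u : admissible d N theta u ->
  exists2 v, control v & realizes u v.
Proof.
move=> adm.
have h k : exists y, adapted k y /\ ((k <= N - d)%N -> forall w, u k w = y (mpath w)).
  have [kN|kN] := leqP k (N - d); last by exists (fun=> 0).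
  by have [y ya yE] := past_measurable_path (adm k kN); exists y.
have [y hy] := choice h.
exists (fun k => if (k < d)%N then fun=> initial_input k
  else if (k <= N)%N then y (k - d)%N else fun=> 0) => [|k w kN].
  split=> [k|k l kN|k l kd]; last by rewrite kd.
    by case: ifP => // _; case: ifP => // _; exact: (hy _).1.
  by rewrite !ifF //; lia.
have [kd|dk] := ltnP k d; first by rewrite input_early.
by rewrite kN input_late // (hy _).2 //; lia.
Qed.

Lemma state_path u v k w : realizes u v -> (k <= N.+1)%N ->
  state S d theta u k w = xs S v k (mpath w).
Proof.
by move=> uv; elim: k => //= k IH kN; rewrite IH ?uv // ltnW.
Qed.

Lemma cost_path u v : control v -> realizes u v ->
  cost P S d N theta u = (pcost S d N p0 v)%:E.
Proof.
move=> [va _ _] uv; rewrite /pcost -(expectation_path htheta); last first.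
  move=> l l' ag; rewrite /path_cost ag //; congr (_ + _ + _).
  - apply: eq_big_nat => k kN; rewrite ag; last by lia.
    by rewrite (adapted_xsW S hd hN va (k := k) (l' := l')) //; apply: agreeW ag; lia.
  - apply: eq_big_nat => k kN; rewrite ag; last by lia.
    by rewrite (va k l l') //; apply: agreeW ag; lia.
  - by rewrite (adapted_xsW S hd hN va (k := N.+1) (l' := l')).
rewrite /cost unlock; apply: eq_integral => w _; congr (_%:E).
rewrite /path_cost (state_path w uv) //; congr (_ + _ + _).
  by apply: eq_big_nat => k kN; rewrite (state_path w uv) //; lia.
by apply: eq_big_nat => k kN; rewrite uv //; lia.
Qed.

Lemma optimal_path u v : admissible d N theta u -> control v -> realizes u v ->
  optimal P S d N theta u <-> poptimal v.
Proof.
move=> adm cv uv; split=> -[_ opt]; split=> //.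
  move=> v' cv'; have [u' adm' uv'] := control_realizes cv'.
  by have := opt u' adm'; rewrite (cost_path cv uv) (cost_path cv' uv') lee_fin.
move=> u' adm'; have [v' cv' uv'] := admissible_realizes adm'.
by rewrite (cost_path cv uv) (cost_path cv' uv') lee_fin; exact: opt.
Qed.

Lemma ae_adapted T (Q : Omega -> Prop) :
  (forall w, charged T (mpath w) -> Q w) -> {ae P, forall w, Q w}.
Proof. by move=> h; apply: filterS (ae_charged htheta T) => w /h. Qed.

(** A mode has positive probability at time t exactly when some charged path ends in it, and W
    depends on that mode alone. *)
Lemma W_positiveP :
  (forall k, (d <= k <= N)%N -> forall l : 'I_L,
      (0 < P (theta (k - d)%N @^-1` [set l]))%E -> posdef_mx (ric_W X (k - d) l))
  <-> forall t, (t <= N - d)%N -> W_pos_on S X p0 t.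
Proof.
split=> [wp t tN l ch|wp k kN i Pi].
  have tdN : (d <= t + d <= N)%N by lia.
  have := wp (t + d)%N tdN; rewrite addnK => h; apply: h.
  rewrite lt_neqAle eq_sym measure_ge0 andbT; apply/negP => /eqP z.
  have : P (cyl theta t l) = 0%E.
    apply/eqP; rewrite -measure_le0 -z; apply: le_measure; rewrite ?inE.
    - exact: (measurable_cyl htheta).
    - exact: (measurable_mode htheta).
    - by move=> w /(_ t (leqnn t)).
  rewrite (P_cyl htheta) => -[/eqP]; apply/negP.
  by rewrite weight_charged; apply/asboolP.
have [[l ch li]|no] := pselect (exists2 l, charged (k - d) l & l (k - d)%N = i).
  by rewrite -li; apply: wp ch; lia.
have [A [mA A0 sA]] := ae_charged htheta (k - d).
suff : (P (theta (k - d)%N @^-1` [set i]) <= 0)%E by rewrite leNgt Pi.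
rewrite -A0; apply: le_measure; rewrite ?inE //; first exact: (measurable_mode htheta).
by move=> w /= wi; apply: sA => /= ch; apply: no; exists (mpath w).
Qed.

Lemma control_exists : exists v, control v.
Proof.
exists (fun k => if (k < d)%N then fun=> initial_input k else fun=> 0).
split=> [k|k l kN|k l kd]; [by case: ifP|by rewrite ifF //; lia|by rewrite kd].
Qed.

Lemma unique_optimalP : unique_optimal P S d N theta <->
  forall t, (t <= N - d)%N -> W_pos_on S X p0 t.
Proof.
split=> [[u opt uniq]|wp].
  have [v cv uv] := admissible_realizes opt.1.
  apply: (W_pos_of_unique hd hN (lam_sum1 htheta) hQ hR hP hX hX' (u0 := initial_input) (lam_ge0 htheta)).
  - exact: initial_law_ge0.
  - by exists v; apply/(optimal_path opt.1 cv uv).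
  have agr v1 : poptimal v1 -> forall k l, (k <= N)%N -> charged (k - d) l ->
      v1 k l = v k l.
    move=> o1 k l kN; have c1 := o1.1; have [kd|dk] := ltnP k d.
      by case: c1 => _ _ h1; case: cv => _ _ h; rewrite h1 // h.
    have [u1 a1 uv1] := control_realizes c1.
    have ou1 : optimal P S d N theta u1 by apply/(optimal_path a1 c1 uv1).
    have kd : (k - d <= N - d)%N by lia.
    have QT : adapted (k - d) (fun l => v1 k l = v k l).
      case: c1 => va1 _ _; case: cv => va _ _ l1 l2 ag.
      by rewrite (va1 k l1 l2) // (va k l1 l2).
    apply: (charged_ae htheta QT).
    apply: filterS (uniq u1 ou1 (k - d)%N kd) => w.
    by rewrite -(uv1 k w kN) -(uv k w kN) !input_late.
  by move=> v1 v2 o1 o2 k l kN ch; rewrite (agr v1) // (agr v2).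
have [v cv fb] := feedback_exists S X hd hN control_exists.
have optP := poptimalP hd hN (lam_sum1 htheta) hQ hR hP hX hX' initial_input (lam_ge0 htheta)
  (@initial_law_ge0 _ _ _ P _ theta) wp.
have [u adm uv] := control_realizes cv.
exists u; first by apply/(optimal_path adm cv uv)/optP; split=> // t tN l _; exact: fb.
move=> u' opt' k kN; have [v' cv' uv'] := admissible_realizes opt'.1.
have [_ fb'] := (optP v').1 ((optimal_path opt'.1 cv' uv').1 opt').
apply: (ae_adapted (T := k)) => w ch.
have kdN : (k + d <= N)%N by lia.
have := uv (k + d)%N w kdN; have := uv' (k + d)%N w kdN.
rewrite !input_late ?leq_addl // addnK => -> ->.
apply: (feedback_unique hd hN cv' cv fb' (fun t tN l _ => fb t tN l)) => //.
by rewrite addnK.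
Qed.

(** * Formulas for the optimal control, costate and cost *)

Section OptimalControl.
Variables (u : nat -> Omega -> 'cV[R]_m) (v : nat -> (nat -> 'I_L) -> 'cV[R]_m).
Hypotheses (cv : control v) (uv : realizes u v).
Hypothesis fb : forall t, (t <= N - d)%N -> forall l, charged t l -> feedback S d N X v t l.

Lemma optimal_control_formula k : (d <= k <= N)%N -> {ae P, forall w,
  let l := theta (k - d)%N w in
  u (k - d)%N w =
  - (invmx (ric_W X (k - d) l) *m ric_T0 X (k - d) l
     *m state S d theta u (k - d + 1)%N w)
  - \sum_(1 <= j < d)
      invmx (ric_W X (k - d) l) *m ric_T X j (k - d) l
      *m input S u (k%:Z - (2 * d)%N%:Z + j%:Z) w}.
Proof.
move=> kN; apply: (ae_adapted (T := k - d)) => w ch /=.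
have kdN : (k - d <= N - d)%N by lia.
rewrite -input_late; last by lia.
rewrite uv; last by lia.
have := fb kdN ch; rewrite /feedback subnK; last by lia.
move=> ->; rewrite /Winv /W_inv kdN /gain mulmxDr opprD addn1.
rewrite (state_path w uv); last by lia.
rewrite mulmxA; congr (_ - _).
rewrite mulmx_sumr subn1 -(big_mkord xpredT (fun i => invmx (ric_W X (k - d) (mpath w (k - d)%N))
  *m (T_ X i.+1 (k - d) (mpath w) *m v (k - d + i.+1)%N (mpath w)))).
rewrite [RHS]big_add1; apply: eq_big_nat => j jd; rewrite mulmxA; congr (_ *m _).
rewrite -uv; last by lia.
by congr input; lia.
Qed.

(** By [Lambda_alpha] the conditional expectations are truncated gains, but only on charged paths; a
    single path function [c] accounts for the chosen versions elsewhere. *)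
Lemma correction_path k : (d <= k <= N)%N ->
  exists c : (nat -> 'I_L) -> 'cV[R]_n, [/\ adapted (k - 1) c,
    forall w, \sum_(1 <= s < d)
      (ric_alpha X (d - s) (k - 1) (k - s) (fun t => theta t w))^T
      *m W_inv d N X (k - s - 1) (theta (k - s - 1)%N w)
      *m cond_exp_vec P (past theta (k - s - 1)) (fun w =>
           ric_alpha X (d - s) (k - 1) (k - s) (fun t => theta t w)
           *m state S d theta u k w) w = c (mpath w) &
    forall l, charged (k - 1) l -> c l = \sum_(1 <= s < d)
      (alpha_ d X s (k - 1) l)^T *m Winv d N X (k - 1 - s) l *m gain S X v s (k - 1 - s) l].
Proof.
move=> kN; have kE : (k - 1).+1 = k by lia.
have [va _ _] := cv.
have aX : adapted (k - 1) (xs S v k) by rewrite -{2}kE; exact: (adapted_xs S hd hN va).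
have aa s : (1 <= s < d)%N -> adapted (k - 1) (alpha_ d X s (k - 1)).
  by move=> sd; apply: (adapted_alpha hd hN hX'); lia.
have h s : exists y : (nat -> 'I_L) -> 'cV[R]_m, (1 <= s < d)%N ->
    [/\ adapted (k - 1 - s) y,
     forall w, cond_exp_vec P (past theta (k - s - 1)) (fun w =>
           ric_alpha X (d - s) (k - 1) (k - s) (fun t => theta t w)
           *m state S d theta u k w) w = y (mpath w) &
     forall l, charged (k - 1 - s) l -> y l = Lambda (trans S) (k - 1 - s) (k - 1)
       (fun l => alpha_ d X s (k - 1) l *m xs S v k l) l].
  have [sd|sd] := boolP (1 <= s < d)%N; last by exists (fun=> 0).
  have af : adapted (k - 1) (fun l => alpha_ d X s (k - 1) l *m xs S v k l).
    by move=> l l' ag; rewrite (aa s sd l l' ag) (aX l l' ag).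
  have [y [ay yE yL]] := cond_exp_vec_path htheta (leq_subr s (k - 1)) af.
  exists y => _; split=> // w; rewrite -yE subnAC.
  apply: eq_cond_exp_vec => w'.
  by rewrite (state_path w' uv) /alpha_ ?kE //; lia.
have [y hy] := choice h.
exists (fun l => \sum_(1 <= s < d)
  (alpha_ d X s (k - 1) l)^T *m Winv d N X (k - 1 - s) l *m y s l).
split=> [l l' ag|w|l ch]; apply: eq_big_nat => s sd; have [ys yE yL] := hy s sd.
- rewrite (aa s sd l l' ag) (ys l l'); last by apply: agreeW ag; lia.
  by rewrite /Winv ag //; lia.
- by rewrite yE /alpha_ kE /Winv subnAC.
rewrite yL; last by apply: chargedW ch; lia.
have [tN|tN] := leqP (k - 1 - s) (N - d); last by rewrite Winv_late // mulmx0 !mul0mx.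
have := @Lambda_alpha _ _ _ _ _ _ _ _ hd hN hQ hR hP hX hX' _ _ cv s (k - 1) l.
by rewrite kE => -> //; lia.
Qed.

Lemma costate_rev_path j : (j <= N)%N -> exists y : (nat -> 'I_L) -> 'cV[R]_n,
  [/\ adapted (N - j) y,
      forall w, costate_rev P S d N theta u j w = y (mpath w) &
      forall l, charged (N - j) l -> y l = costate_form S d X v (N - j) l].
Proof.
have [va _ _] := cv; elim: j => [_|j IH jN].
  rewrite subn0.
  have af : adapted N.+1 (fun l => costP S (l N.+1) *m xs S v N.+1 l).
    by move=> l l' ag; rewrite ag // (adapted_xsW S hd hN va (k := N.+1) (l' := l')).
  have [y [ay yE yL]] := cond_exp_vec_path htheta (leqnSn N) af.
  exists y; split=> [|w|l ch]; first exact: ay; last first.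
    by rewrite yL //; exact: (costate_last hd hN hX cv).
  rewrite -yE; transitivity (cond_exp_vec P (past theta N)
    (fun w => costP S (theta N.+1 w) *m state S d theta u N.+1 w) w); first by [].
  apply: eq_cond_exp_vec => w'.
  by rewrite (state_path w' uv).
have [y [ay yE yL]] := IH (ltnW jN).
have NjE : (N - j.+1).+1 = (N - j)%N by lia.
have af : adapted (N - j) (fun l => (A_ S (N - j) l)^T *m y l
    + Q_ S (N - j) l *m xs S v (N - j) l).
  move=> l l' ag; rewrite (ay l l' ag) (adapted_xsW S hd hN va ag) (adapted_A _ ag).
  by rewrite /Q_ ag.
have [y' [ay' yE' yL']] := cond_exp_vec_path htheta (leq_sub2l N (leqnSn j)) af.
exists y'; split=> [|w|l ch]; first exact: ay'.
  rewrite -yE'; transitivity (cond_exp_vec P (past theta (N - j.+1)) (fun w =>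
    (sysA S (N - j) (theta (N - j)%N w))^T *m costate_rev P S d N theta u j w
    + costQ S (N - j) (theta (N - j)%N w) *m state S d theta u (N - j) w) w); first by [].
  apply: eq_cond_exp_vec => w'.
  by rewrite yE (state_path w' uv) //; lia.
rewrite yL' // -(costate_step hd hN hQ hR hP hX hX' cv fb) //; last by lia.
rewrite NjE; apply: Lambda_eq_reach => l' rch; rewrite yL //.
exact: reach_charged ch rch.
Qed.

Lemma costate_formula k : (d <= k <= N)%N -> {ae P, forall w,
  costate P S d N theta u (k - 1) w =
  (ric_P X (k - 1) (theta (k - 1)%N w) - ric_P0 X (k - 1) (theta (k - 1)%N w))
    *m state S d theta u k w
  - \sum_(1 <= s < d)
      (ric_alpha X (d - s) (k - 1) (k - s) (fun t => theta t w))^T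
      *m W_inv d N X (k - s - 1) (theta (k - s - 1)%N w)
      *m cond_exp_vec P (past theta (k - s - 1)) (fun w =>
           ric_alpha X (d - s) (k - 1) (k - s) (fun t => theta t w)
           *m state S d theta u k w) w}.
Proof.
move=> kN; have [c [_ cE cL]] := correction_path kN.
apply: (ae_adapted (T := k - 1)) => w ch; rewrite cE cL // /costate.
have jN : (N - (k - 1) <= N)%N by exact: leq_subr.
have [y [_ yE yL]] := costate_rev_path jN.
rewrite subKn in yL; last by lia.
rewrite yE yL // (costate_form_alpha hd hN hX' cv fb) //; try lia.
rewrite (state_path w uv); last by lia.
by rewrite (_ : (k - 1).+1 = k) //; lia.
Qed.

Lemma optimal_cost_formula : (forall t, (t <= N - d)%N -> W_pos_on S X p0 t) ->
  cost P S d N theta u = ('E_P[fun w => (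
    \sum_(0 <= k < d) qform (costQ S k (theta k w)) (state S d theta u k w)
    + qform (ric_P X (d - 1) (theta (d - 1)%N w)
             - ric_P0 X (d - 1) (theta (d - 1)%N w)) (state S d theta u d w)
    - ((state S d theta u d w)^T *m \sum_(1 <= s < d)
      (ric_alpha X (d - s) (d - 1) (d - s) (fun t => theta t w))^T
      *m W_inv d N X (d - s - 1) (theta (d - s - 1)%N w)
      *m cond_exp_vec P (past theta (d - s - 1)) (fun w =>
           ric_alpha X (d - s) (d - 1) (d - s) (fun t => theta t w)
           *m state S d theta u d w) w) 0 0)%R])%E.
Proof.
move=> wp; have [va _ _] := cv.
have dN : (d <= d <= N)%N by lia.
have [c [ac cE cL]] := correction_path dN.
pose f l : R := \sum_(0 <= k < d) qform (costQ S k (l k)) (xs S v k l)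
  + qform (Pd X (d - 1) l) (xs S v d l) - ((xs S v d l)^T *m c l) 0 0.
have dE : (d - 1).+1 = d by lia.
have ax k : adapted k (xs S v k) by exact: (adapted_xsW S hd hN va).
have af : adapted d f.
  move=> l l' ag; rewrite /f (ax d l l' ag) (ac l l'); last by apply: agreeW ag; lia.
  rewrite (adapted_Pd _ (agreeW (leq_subr 1 d) ag)); congr (_ + _ - _).
  apply: eq_big_nat => k kd; rewrite (ax k l l') ?ag //; first by lia.
  by apply: agreeW ag; lia.
rewrite (cost_path cv uv) unlock.
transitivity (\int[P]_w (f (mpath w))%:E)%E; last first.
  apply: eq_integral => w _; congr (_%:E); rewrite cE /f.
  rewrite (state_path w uv); last by lia.
  congr (_ + _ - _); apply: eq_big_nat => k kd.
  by rewrite (state_path w uv) //; lia.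
have afN : adapted N.+1 f by apply: adaptedW af; lia.
rewrite (expectation_path htheta afN); congr (_%:E).
have d1N : (d - 1 <= N)%N by lia.
rewrite (pcost_value_form hd hN (lam_sum1 htheta) hQ hR hP hX hX' cv fb d1N wp).
rewrite (value_form_costate_form hd hN (lam_sum1 htheta) hQ hR hP hX hX' cv fb wp) dE -EP_sum -EPD.
apply: EP_eq => l ch; have ch' : charged (d - 1) l by apply: chargedW ch; lia.
rewrite /f cL // (costate_form_alpha hd hN hX' cv fb) ?dE //; last by lia.
rewrite addrC -addrA; congr (_ + _); last first.
  by rewrite mulmxBr mulmxA [LHS]mxE [X in _ + X]mxE.
by apply: eq_big_nat => k kd; rewrite /running /R_ leqNgt (andP kd).2 mulmx0 mul0mx addr0.
Qed.

End OptimalControl.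

End Bridge.

Theorem theorem1 (R : realType) (disp : measure_display)
    (Omega : measurableType disp) (P : probability Omega R)
    (L n m d N : nat) (theta : nat -> Omega -> 'I_L)
    (S : mjls R L n m) (X : riccati R L n m)
    (hd : (0 < d)%N) (hN : (d < N)%N)
    (htheta : markov_chain P (trans S) theta)
    (hQ : forall k l, (k <= N)%N -> possemidef_mx (costQ S k l))
    (hR : forall k l, (d <= k <= N)%N -> possemidef_mx (costR S k l))
    (hP : forall l, symmetric_mx (costP S l))
    (hX : solves_cdre S d N X)
    (hX' : solves_auxiliary S d N X) :
  let x := state S d theta in
  let W_positive :=
    forall k, (d <= k <= N)%N -> forall l : 'I_L,
      (0 < P (theta (k - d)%N @^-1` [set l]))%E ->
      posdef_mx (ric_W X (k - d) l) in
  let alpha_x u k s w :=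
    ric_alpha X (d - s) (k - 1) (k - s) (fun t => theta t w) *m x u k w in
  let correction u k w :=
    \sum_(1 <= s < d)
      (ric_alpha X (d - s) (k - 1) (k - s) (fun t => theta t w))^T
      *m W_inv d N X (k - s - 1) (theta (k - s - 1)%N w)
      *m cond_exp_vec P (past theta (k - s - 1)) (alpha_x u k s) w in
  (unique_optimal P S d N theta <-> W_positive)
  /\
  (W_positive -> forall u, optimal P S d N theta u ->
    [/\ forall k, (d <= k <= N)%N -> {ae P, forall w,
          let l := theta (k - d)%N w in
          u (k - d)%N w =
          - (invmx (ric_W X (k - d) l) *m ric_T0 X (k - d) l
             *m x u (k - d + 1)%N w)
          - \sum_(1 <= j < d)
              invmx (ric_W X (k - d) l) *m ric_T X j (k - d) l
              *m input S u (k%:Z - (2 * d)%N%:Z + j%:Z) w},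
        forall k, (d <= k <= N)%N -> {ae P, forall w,
          costate P S d N theta u (k - 1) w =
          (ric_P X (k - 1) (theta (k - 1)%N w)
           - ric_P0 X (k - 1) (theta (k - 1)%N w)) *m x u k w
          - correction u k w} &
        cost P S d N theta u =
        ('E_P[fun w => (
          \sum_(0 <= k < d) qform (costQ S k (theta k w)) (x u k w)
          + qform (ric_P X (d - 1) (theta (d - 1)%N w)
                   - ric_P0 X (d - 1) (theta (d - 1)%N w)) (x u d w)
          - ((x u d w)^T *m correction u d w) 0 0)%R])%E]).
Proof.
move=> x W_positive alpha_x correction.
have wP := W_positiveP X hd hN htheta.
have uP := unique_optimalP hd hN htheta hQ hR hP hX hX'.
split; first by rewrite uP -wP.
move=> /wP wp u opt; have [v cv uv] := admissible_realizes S hd hN opt.1.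
have popt := (optimal_path hd hN htheta opt.1 cv uv).1 opt.
have [_ fb] := (poptimalP hd hN (lam_sum1 htheta) hQ hR hP hX hX' _ (lam_ge0 htheta)
  (@initial_law_ge0 _ _ _ P _ theta) wp v).1 popt.
split.
- exact: (optimal_control_formula hd hN htheta uv fb).
- exact: (costate_formula hd hN htheta hQ hR hP hX hX' cv uv fb).
- exact: (optimal_cost_formula hd hN htheta hQ hR hP hX hX' cv uv fb wp).
Qed.
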